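(* Let $h^{(N)}>0$, $b^{(N)}>0$ be sequences such that $\gamma_N=\frac{Nh^{(N)}}{Nh^{(N)}+b^{(N)}}$ satisfies $\gamma_N=\gamma$ for all $N$, for some fixed $\gamma\in(0,1)$. Let $(I_N^A,\beta_N^A)$ be the minimizer of $F_N$ and let $\hat I_N^A$ be the minimizer of $\hat C_N^A$ (both functions defined in the context). Then, as $N\to\infty$, $$I_N^A=\frac{\sigma^2}{2}\log N+\frac{\sigma\sigma_A}{\sqrt2}\sqrt{\log N}\,\Phi^{-1}(1-\gamma)+o(\sqrt{\log N}),$$ and $$F_N(I_N^A,\beta_N^A)=2\sqrt N\sqrt{\hat C_N^A(\hat I_N^A)}+o\big(N\sqrt{h^{(N)}}\big).$$
   Context: Fix $\sigma>0$, $\sigma_A>0$. Let $W_1,W_2,\dots$ be independent Brownian motions started at $0$ with mean $0$ and variance $\sigma^2$ ($\mathrm{Var}(W_i(t))=\sigma^2t$), and $W_A$ a Brownian motion started at $0$ with mean $0$ and variance $\sigma_A^2$, independent of the $W_i$. Let $Q_i=\sup_{s>0}(W_i(s)+W_A(s)-s)$. For $N\ge2$, $I\in\mathbb R$, $\beta>0$ define, with $x^+=\max(x,0)$, $$C_N(I)=\mathbb E\Big[Nh^{(N)}(I-Q_i)+(Nh^{(N)}+b^{(N)})\big(\max_{j\le N}Q_j-I\big)^+\Big],\qquad F_N(I,\beta)=\frac1\beta C_N(I)+\beta N,$$ (the $Q_i$ are identically distributed, so the choice of $i$ is irrelevant) and $$\hat C_N^A(I)=\mathbb E\Big[Nh^{(N)}(I-Q_i)+(Nh^{(N)}+b^{(N)})\big(\tfrac{\sigma^2}{2}\log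 N+\tfrac{\sigma\sigma_A}{\sqrt2}\sqrt{\log N}\,X-I\big)^+\Big],$$ with $X\sim\mathcal N(0,1)$. $(I_N^A,\beta_N^A)$ denotes the minimizer of $F_N$ over $I\in\mathbb R$, $\beta>0$, and $\hat I_N^A$ the minimizer of $\hat C_N^A$ over $\mathbb R$. $\Phi^{-1}$ is the quantile function of the standard normal distribution. *)

(* Defs.v *)
From HB Require Import structures.
From mathcomp Require Import all_boot all_order all_algebra finmap.
From mathcomp Require Import all_classical all_reals all_analysis.

Set Implicit Arguments.
Unset Strict Implicit.
Unset Printing Implicit Defensive.

Import Order.TTheory GRing.Theory Num.Theory.
Import numFieldNormedType.Exports.

Local Open Scope classical_set_scope.
Local Open Scope ring_scope.

Section independence.
Context d (T : measurableType d) (R : realType) (P : probability T R).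

Definition mutually_independent (I : choiceType) (G : I -> set_system T) :=
  forall (J : {fset I}) (E : I -> set T), (forall j, j \in J -> G j (E j)) ->
    P (\bigcap_(j in [set` J]) E j) = (\prod_(j <- J) P (E j))%E.

Definition sigma_rv (X : T -> R) : set_system T :=
  preimage_set_system setT X measurable.

(* Processes are indexed by R, but only their values at nonnegative times are
   ever constrained or used. *)
Definition sigma_process (X : R -> {RV P >-> R}) : set_system T :=
  <<s \bigcup_(t in [set t : R | 0 <= t]) sigma_rv (X t) >>.

End independence.

Section brownian_motion.
Context d (T : measurableType d) (R : realType) (P : probability T R).

(* [normal_prob m s] has standard deviation [s], whence the square root. *)
Record brownian_motion (sigma : R) (B : R -> {RV P >-> R}) : Prop := {
  bm_start : {ae P, forall w, B 0 w = 0} ;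
  bm_increments : forall t : nat -> R,
    0 <= t 0%N -> {homo t : m n / (m <= n)%N >-> m <= n} ->
    mutually_independent P
      (fun k : nat => sigma_rv (B (t k.+1) \- B (t k))) ;
  bm_normal : forall s t : R, 0 <= s -> s < t ->
    forall A : set R, measurable A ->
    pushforward P (B t \- B s) A =
      normal_prob 0 (sigma * Num.sqrt (t - s)) A ;
  bm_continuous :
    {ae P, forall w, {within `[0, +oo[, continuous (fun t => B t w)}} }.

End brownian_motion.

Section normal.
Context (R : realType).

Definition normal_cdf (x : R) : R := fine (normal_prob (0 : R) 1 `]-oo, x]).

Definition normal_quantile (p : R) : R := inf [set x | p <= normal_cdf x].

End normal.

Section queues.
Local Open Scope ereal_scope.
Context d (T : measurableType d) (R : realType) (P : probability T R).
Variables (W : nat -> R -> {RV P >-> R}) (WA : R -> {RV P >-> R}).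

(* Almost surely finite, but possibly +oo on a negligible set, hence the
   extended reals here and in the cost functions. The numbering of the queues
   starts at 0: the first N queues are j < N. *)
Definition queue (i : nat) (w : T) : \bar R :=
  ereal_sup [set (W i s w + WA s w - s)%:E | s in [set s : R | (0 < s)%R]].

Definition max_queue (N : nat) (w : T) : \bar R :=
  \big[maxe/-oo]_(j < N) queue j w.

(* [h] and [b] stand for the values at N of the cost sequences; [i] is the
   index of the queue appearing in the linear term. *)
Definition cost (i N : nat) (h b I : R) : \bar R :=
  \int[P]_w ((N%:R * h)%:E * (I%:E - queue i w) +
             (N%:R * h + b)%:E * maxe (max_queue N w - I%:E) 0).

Definition total_cost (i N : nat) (h b I beta : R) : \bar R :=
  (beta^-1)%:E * cost i N h b I + (beta * N%:R)%:E.

Definition approx_max_queue (sigma sigmaA : R) (N : nat) (x : R) : R :=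
  (sigma ^+ 2 / 2 * ln N%:R +
   sigma * sigmaA / Num.sqrt 2 * Num.sqrt (ln N%:R) * x)%R.

Definition approx_cost (sigma sigmaA : R) (X : {RV P >-> R})
    (i N : nat) (h b I : R) : \bar R :=
  \int[P]_w ((N%:R * h)%:E * (I%:E - queue i w) +
    (N%:R * h + b)%:E *
      maxe ((approx_max_queue sigma sigmaA N (X w))%:E - I%:E) 0).

End queues.

(* Main.v *)
(* After dividing by [N h], both costs are functions of the rescaled base-stock
   level [x], where [I = s + sigmaA sqrt(s) x] and [s = (sigma^2 / 2) ln N]:
   up to the same constant they equal [x + E(Y - x)^+ / gamma], with [Y] standard
   normal for the approximate cost and [Y = (max_j Q_j - s) / (sigmaA sqrt(s))]
   for the exact one. It suffices that these convex functions converge pointwise,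
   since the limit has its strict minimum at the (1 - gamma)-quantile.
   The instant [s] is where [sigma sqrt(2 t ln N) - t], the asymptotic maximum
   of the [W_j(t) - t], is largest, with value [s]; so [max_j Q_j] should be
   [s + W_A(s)] up to [o(sqrt s)].
   Lower bound: look only at time [s], where [max_j W_j(s)] is close to [2 s]
   with high probability, independently of [W_A(s)].
   Upper bound: compare each [W_j] with the tangents to [sigma sqrt(2 t ln N)]
   of slope [1 - eta] (for [t >= s]) and [1 + eta] (for [t <= s]). The supremum
   of a Brownian motion with drift [-c] exceeds [a] by at most
   [exp(- 2 c a / sigma^2) sigma^2 / (2 c)] in mean, so the union bound over
   [j < N] costs O(1), and the leftover drift [eta |t - s|] absorbs the increments
   of [W_A] around [s] at a cost O(1 / eta). The total error
   O(1 + s eta^2 + 1 / eta) is o(sqrt s) for a suitable [eta]. *)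

Require Import Defs.
From HB Require Import structures.
From mathcomp Require Import all_boot all_order all_algebra finmap.
From mathcomp Require Import all_classical all_reals all_analysis.
From mathcomp Require Import measurable_realfun.
From mathcomp Require Import ring lra zify.

Set Implicit Arguments.
Unset Strict Implicit.
Unset Printing Implicit Defensive.

Import Order.TTheory GRing.Theory Num.Theory.
Import numFieldNormedType.Exports.

Local Open Scope classical_set_scope.
Local Open Scope ring_scope.

(** * Gaussian integrals *)

Section normal_integral.
Context (R : realType).
Local Open Scope ereal_scope.
Local Notation mu := (@lebesgue_measure R).

(** The Radon-Nikodym derivative of [normal_prob] agrees almost everywhere with [normal_pdf], since
    both have the same integral over every measurable set. *)
Lemma ge0_integral_normal_prob (m s : R) (f : R -> \bar R) :
  measurable_fun [set: R] f -> (forall x, 0 <= f x) ->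
  \int[normal_prob m s]_x f x = \int[mu]_x (f x * (normal_pdf m s x)%:E).
Proof.
move=> mf f0.
have dom := normal_prob_dominates m s.
rewrite -(Radon_Nikodym_SigmaFinite.change_of_variables dom)//=.
have fi := Radon_Nikodym_SigmaFinite.f_integrable dom.
apply: ae_eq_integral => //.
- apply: emeasurable_funM => //; exact: measurable_int fi.
- apply: emeasurable_funM => //=; apply/measurableT_comp => //=.
  exact: measurable_normal_pdf.
- apply: ae_eqe_mul2l => /=.
  apply: integral_ae_eq => //=.
  + by apply/measurableT_comp => //; exact: measurable_normal_pdf.
  + move=> E _ mE.
    by rewrite -(Radon_Nikodym_SigmaFinite.f_integral dom)//.
Qed.

(** Exponential tilting: completing the square turns [expR (t * x)] times the centered density into
    a constant times the density of mean [t * s ^+ 2], whose integral is 1. *)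
Lemma normal_mgf (s t : R) : (0 < s)%R ->
  \int[normal_prob 0 s]_x (expR (t * x))%:E = (expR (t ^+ 2 * s ^+ 2 / 2))%:E.
Proof.
move=> s0; rewrite ge0_integral_normal_prob; last 2 first.
- by apply/measurable_EFinP; apply: measurableT_comp => //; exact: mulrl_measurable.
- by move=> x; rewrite lee_fin expR_ge0.
have tilt x : (expR (t * x) * normal_pdf 0 s x)%R =
    (expR (t ^+ 2 * s ^+ 2 / 2) * normal_pdf (t * s ^+ 2) s x)%R.
  rewrite !normal_pdfE ?gt_eqF// !(mulrCA _ (normal_peak s)).
  congr (_ * _)%R; rewrite /normal_fun -!expRD; congr expR.
  have ? : (s != 0)%R by rewrite gt_eqF.
  by field.
under eq_integral => x _ do rewrite -EFinM tilt EFinM.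
rewrite ge0_integralZl//=.
- by rewrite integral_normal_pdf mule1.
- by apply/measurable_EFinP; exact: measurable_normal_pdf.
- by move=> x _; rewrite lee_fin normal_pdf_ge0.
Qed.

Lemma normal_scale (s : R) (g : R -> R) : (0 < s)%R ->
  continuous g -> (forall x, (0 <= g x)%R) ->
  \int[normal_prob 0 s]_x (g x)%:E = \int[normal_prob 0 1]_x (g (s * x)%R)%:E.
Proof.
move=> s0 cg g0.
have cgs : continuous (fun x : R => g (s * x)%R).
  by move=> x; apply: (@continuous_comp _ _ _ (fun y => s * y)%R); [exact: mulrl_continuous|exact: cg].
rewrite !ge0_integral_normal_prob; last 4 first.
- by apply/measurable_EFinP; exact: continuous_measurable_fun.
- by move=> x; rewrite lee_fin.
- by apply/measurable_EFinP; exact: continuous_measurable_fun.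
- by move=> x; rewrite lee_fin.
have dF : (fun x : R => s * x)%R^`()%classic = cst s.
  apply/funext => x; rewrite derive1E.
  by rewrite deriveMl// derive_id mulr1.
under [LHS]eq_integral => x _ do rewrite -EFinM.
rewrite (@increasing_ge0_integration_by_substitutionT _ (fun x => s * x)%R (fun x => g x * normal_pdf 0 s x)%R); last 9 first.
- by move=> x y xy; rewrite ltr_pM2l.
- by rewrite dF; exact: cst_continuous.
- by rewrite dF; exact: is_cvg_cst.
- by rewrite dF; exact: is_cvg_cst.
- by move=> x; exact: derivableM.
- by apply: gt0_cvgMrNy => //; exact: cvg_id.
- by apply: gt0_cvgMry => //; exact: cvg_id.
- move=> x; apply: continuousM; first exact: cg.
  by apply: continuous_normal_pdf; rewrite gt_eqF.
- by move=> x; rewrite mulr_ge0// normal_pdf_ge0.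
(* The Jacobian [s] cancels the factor [1 / s] in the peak of the density. *)
apply: eq_integral => x _; rewrite dF/= -EFinM; congr EFin.
rewrite /= -mulrA; congr (_ * _)%R.
rewrite !normal_pdfE ?gt_eqF//.
rewrite mulrAC; congr (_ * _)%R.
  rewrite /normal_peak expr1n mul1r -mulrnAr sqrtrM ?sqr_ge0// sqrtr_sqr gtr0_norm//.
  change ((s * Num.sqrt (pi *+ 2))^-1 * s = (Num.sqrt (pi *+ 2))^-1)%R.
  by rewrite invfM mulrAC mulVf ?mul1r ?gt_eqF.
rewrite /normal_fun; congr expR.
have ? : (s != 0)%R by rewrite gt_eqF.
by field.
Qed.
End normal_integral.

(** * Independence and products *)

Section independence_product.
Context d (T : measurableType d) (R : realType) (P : probability T R).
Local Open Scope ereal_scope.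

(** Both sides are finite measures in [H] that agree on the pi-system [G], hence on the
    sigma-algebra it generates. *)
Lemma indep_sigma_algebra (G : set_system T) (E : set T) :
  G `<=` measurable -> setI_closed G -> G setT -> measurable E ->
  (forall H, G H -> P (H `&` E) = P H * P E) ->
  forall H, <<s G >> H -> P (H `&` E) = P H * P E.
Proof.
move=> Gm GI GT mE GE H GH.
have PE0 : (0 <= fine (P E))%R by rewrite fine_ge0.
pose k := NngNum PE0.
have := @g_sigma_algebra_measure_unique _ R T G Gm (fun=> setT) (fun=> GT) _
   (mrestr P mE) (mscale k P) GI _ _ H GH.
rewrite /= /mrestr /mscale /= fineK ?fin_num_measure// => ->; first by rewrite muleC.
- by rewrite bigcup_const.
- by move=> A GA; rewrite muleC; exact: GE.
- by move=> _; rewrite setTI (le_lt_trans (probability_le1 _ _))// ltry.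
Qed.

(** Independence makes the joint law of [F] and [Y] the product of their laws, and Tonelli's theorem
    factors the integral. *)
Lemma ge0_integralM_indep (F Y : T -> R) :
  measurable_fun setT F -> measurable_fun setT Y ->
  (forall w, 0 <= F w)%R -> (forall w, 0 <= Y w)%R ->
  (forall A B : set R, measurable A -> measurable B ->
    P (F @^-1` A `&` Y @^-1` B) = P (F @^-1` A) * P (Y @^-1` B)) ->
  \int[P]_w (F w * Y w)%:E = \int[P]_w (F w)%:E * \int[P]_w (Y w)%:E.
Proof.
move=> mF mY F0 Y0 FY.
pose F' : {mfun T >-> R} := mfun_Sub (mem_set mF).
pose Y' : {mfun T >-> R} := mfun_Sub (mem_set mY).
have mFY : measurable_fun setT (fun w => (F w, Y w)) by exact/measurable_fun_pairP.
pose FY' : {mfun T >-> (R * R)%type} := mfun_Sub (mem_set mFY).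
(* The absolute values make [f] nonnegative on the whole plane, as Tonelli requires, and change
   nothing on the range of [(F, Y)]. *)
pose f (z : R * R) : \bar R := `|z.1%:E| * `|z.2%:E|.
have mf : measurable_fun setT f.
  apply: emeasurable_funM; apply: measurableT_comp => //.
  - by apply/measurable_EFinP; exact: measurable_fst.
  - by apply/measurable_EFinP; exact: measurable_snd.
have f0 z : 0 <= f z by rewrite mule_ge0.
transitivity (\int[distribution P FY']_z f z).
  rewrite ge0_integral_distribution//; apply: eq_integral => w _.
  by rewrite /f/= !ger0_norm.
rewrite -(@eq_measure_integral _ _ _ setT _ (distribution P F' \x distribution P Y')); last first.
  by move=> A mA _; apply: product_measure_unique => // B C mB mC; exact: FY.
rewrite (fubini_tonelli1 _ mf f0)/= /fubini_F/=.
under eq_integral => x _.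
  rewrite /f/= ge0_integralZl//; last 1 first.
    by apply: measurableT_comp => //; apply/measurable_EFinP.
  over.
rewrite ge0_integralZr//; last 2 first.
- by apply: measurableT_comp => //; apply/measurable_EFinP.
- exact: integral_ge0.
congr (_ * _); (rewrite ge0_integral_distribution//;
    last by apply: measurableT_comp => //; apply/measurable_EFinP);
  by apply: eq_integral => w _ /=; rewrite ger0_norm.
Qed.

Lemma ge0_integralM_sigma_indep (G : set_system T) (F Y : T -> R) :
  G `<=` measurable -> setI_closed G -> G setT ->
  measurable_fun (T := g_sigma_algebraType G) setT F -> measurable_fun setT Y ->
  (forall w, 0 <= F w)%R -> (forall w, 0 <= Y w)%R ->
  (forall H (B : set R), G H -> measurable B ->
    P (H `&` Y @^-1` B) = P H * P (Y @^-1` B)) ->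
  \int[P]_w (F w * Y w)%:E = \int[P]_w (F w)%:E * \int[P]_w (Y w)%:E.
Proof.
move=> Gm GI GT mF mY F0 Y0 GY.
have sGm : <<s G >> `<=` measurable by apply: smallest_sub => //; exact: sigma_algebra_measurable.
apply: ge0_integralM_indep => //.
  by move=> _ A mA; apply: sGm; exact: mF.
move=> A B mA mB; apply: (@indep_sigma_algebra G) => //.
- by rewrite -[X in measurable X]setTI; exact: mY.
- by move=> H GH; exact: GY.
- by rewrite -[_ @^-1` _]setTI; exact: mF.
Qed.

End independence_product.

(** * Maximal inequality for random walks *)

Section random_walk.
Context d (T : measurableType d) (R : realType) (P : probability T R).
Variable X : nat -> T -> R.
Hypothesis mX : forall k, measurable_fun setT (X k).

(** Restricted to the first [n] steps because the increments of a Brownian motion will also be read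
    backwards in time, where only finitely many are available. *)
Definition indep_upto (n : nat) := forall m, (m <= n)%N ->
  forall B : nat -> set R, (forall k, measurable (B k)) ->
    P (\big[setI/setT]_(k < m) (X k @^-1` B k)) =
    (\prod_(k < m) P (X k @^-1` B k))%E.

Definition walk (m : nat) (w : T) : R := \sum_(k < m) X k w.

Fixpoint walk_max (a : R) (m : nat) (w : T) : R :=
  if m is m'.+1 then Num.max (walk_max a m' w) (walk m w) else a.

(** A pi-system of cylinders that generates the sigma-algebra of the first [m] steps; independence
    of the next step is checked on it only. *)
Definition past_system (m : nat) : set_system T :=
  [set H | exists2 B : nat -> set R, (forall k, measurable (B k)) &
    H = \big[setI/setT]_(k < m) (X k @^-1` B k)].

Lemma measurable_rv_preimage k (B : set R) : measurable B ->
  measurable (X k @^-1` B).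
Proof. by move=> mB; rewrite -[X in measurable X]setTI; exact: mX. Qed.

Lemma past_system_measurable m : past_system m `<=` measurable.
Proof.
move=> _ [B mB ->]; elim/big_ind : _ => //; first exact: measurableI.
by move=> k _; exact: measurable_rv_preimage.
Qed.

Lemma past_system_setI m : setI_closed (past_system m).
Proof.
move=> _ _ [B mB ->] [C mC ->]; exists (fun k => B k `&` C k).
  by move=> k; exact: measurableI.
by rewrite -big_split.
Qed.

Lemma past_systemT m : past_system m setT.
Proof. by exists (fun=> setT) => //; rewrite big1. Qed.

Lemma past_measurable m k : (k < m)%N ->
  measurable_fun (T := g_sigma_algebraType (past_system m)) setT (X k).
Proof.
move=> km _ B mB; rewrite setTI; apply: sub_sigma_algebra.
exists (fun j => if j == k then B else setT); first by move=> j; case: ifP.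
rewrite (bigD1 (Ordinal km))//= eqxx big1 ?setIT// => j jk.
by move: jk; rewrite -(inj_eq val_inj)/= => /negbTE ->.
Qed.

Lemma past_measurable_walk m j : (j <= m)%N ->
  measurable_fun (T := g_sigma_algebraType (past_system m)) setT (walk j).
Proof.
move=> jm; rewrite /walk; apply: measurable_sum => k; apply: past_measurable.
exact: leq_trans (ltn_ord k) jm.
Qed.

Lemma past_measurable_walk_max a m j : (j <= m)%N ->
  measurable_fun (T := g_sigma_algebraType (past_system m)) setT (walk_max a j).
Proof.
elim: j => [|j ih] jm; first exact: measurable_cst.
apply: measurable_maxr; first by apply: ih; exact: ltnW.
exact: past_measurable_walk.
Qed.

Lemma measurable_walk j : measurable_fun setT (walk j).
Proof. by rewrite /walk; exact: measurable_sum. Qed.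

Lemma measurable_walk_max a j : measurable_fun setT (walk_max a j).
Proof.
elim: j => [|j ih]; first exact: measurable_cst.
by apply: measurable_maxr => //; exact: measurable_walk.
Qed.

Lemma walk_max_ge a m w : a <= walk_max a m w.
Proof. by elim: m => //= m ih; rewrite le_max ih. Qed.

Lemma walk_le_max a m n w : (0 < m <= n)%N -> walk m w <= walk_max a n w.
Proof.
elim: n => [|n ih]; first by case: m.
case/andP => m0; rewrite leq_eqVlt => /orP[/eqP ->|]; first by rewrite /= le_max lexx orbT.
by rewrite ltnS => mn /=; rewrite le_max ih// m0.
Qed.

Local Open Scope ereal_scope.

(* The potential [R_m - a + exp (th (S_m - R_m)) / th], with [R_m] the running
   maximum started at [a], is a supermartingale: an overshoot [x] of the
   maximum costs [x + 1 / th <= exp (th x) / th]. *)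
Lemma walk_potential (n : nat) (th a : R) : (0 < th)%R ->
  indep_upto n ->
  (forall k, (k < n)%N -> \int[P]_w (expR (th * X k w))%:E <= 1) ->
  forall m, (m <= n)%N ->
  \int[P]_w (walk_max a m w - a)%:E +
  \int[P]_w (expR (th * (walk m w - walk_max a m w)) / th)%:E <=
  (expR (- (th * a)) / th)%:E.
Proof.
move=> th0 ind mgf; elim => [_|m ih mn].
  rewrite /walk/=; under eq_integral do rewrite subrr.
  rewrite integral0 add0e.
  under eq_integral do rewrite big_ord0 sub0r mulrN.
  by rewrite integral_cst//= probability_setT mule1.
apply: le_trans (ih (ltnW mn)).
pose F w := (expR (th * (walk m w - walk_max a m w)))%R.
pose Y w := expR (th * X m w).
have mY : measurable_fun setT Y.
  by apply: measurableT_comp => //; apply: measurable_funM.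
have mF : measurable_fun setT F.
  apply: measurableT_comp => //; apply: measurable_funM => //.
  by apply: measurable_funB; [exact: measurable_walk|exact: measurable_walk_max].
have mU : measurable_fun setT (fun w => (walk_max a m w - a)%:E).
  by apply/measurable_EFinP; apply: measurable_funB => //; exact: measurable_walk_max.
have mU1 : measurable_fun setT (fun w => (walk_max a m.+1 w - a)%:E).
  by apply/measurable_EFinP; apply: measurable_funB => //; exact: measurable_walk_max.
have mF1 : measurable_fun setT (fun w => (expR (th * (walk m.+1 w - walk_max a m.+1 w)) / th)%:E).
  apply/measurable_EFinP; apply: measurable_funM => //.
  apply: measurableT_comp => //; apply: measurable_funM => //.
  by apply: measurable_funB; [exact: measurable_walk|exact: measurable_walk_max].
have mFth : measurable_fun setT (fun w => (F w / th)%:E).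
  by apply/measurable_EFinP; apply: measurable_funM.
have mFY : measurable_fun setT (fun w => (F w * Y w / th)%:E).
  by apply/measurable_EFinP; apply: measurable_funM => //; apply: measurable_funM.
have U0 j w : 0 <= (walk_max a j w - a)%:E by rewrite lee_fin subr_ge0 walk_max_ge.
have th'0 : (0 <= th^-1)%R by rewrite invr_ge0 ltW.
have EFY : \int[P]_w (F w * Y w / th)%:E <= \int[P]_w (F w / th)%:E.
  under eq_integral do rewrite EFinM.
  under [leRHS]eq_integral do rewrite EFinM.
  rewrite !ge0_integralZr//; last 4 first.
  - by apply/measurable_EFinP.
  - by move=> w _; rewrite lee_fin expR_ge0.
  - by apply/measurable_EFinP; apply: measurable_funM.
  - by move=> w _; rewrite lee_fin mulr_ge0// expR_ge0.
  apply: lee_wpmul2r; first by rewrite lee_fin.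
  rewrite (@ge0_integralM_sigma_indep _ _ _ _ (past_system m))//.
  - rewrite -[leRHS]mule1 lee_wpmul2l//; last exact: mgf.
    by apply: integral_ge0 => w _; rewrite lee_fin expR_ge0.
  - exact: past_system_measurable.
  - exact: past_system_setI.
  - exact: past_systemT.
  - apply: measurableT_comp => //; apply: measurable_funM => //.
    by apply: measurable_funB; [exact: past_measurable_walk|exact: past_measurable_walk_max].
  - by move=> w; exact: expR_ge0.
  - by move=> w; exact: expR_ge0.
  - move=> _ B [C mC ->] mB.
    (* A past cylinder together with an event on step [m] is a cylinder over [m.+1] steps, to which
       [ind] applies. *)
    pose C' k := if k == m then (fun x => expR (th * x)) @^-1` B else C k.
    have mC' k : measurable (C' k).
      rewrite /C'; case: ifP => // _; rewrite -[X in measurable X]setTI.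
      have : measurable_fun [set: R] (fun x => expR (th * x)).
        by apply: measurableT_comp => //; exact: mulrl_measurable.
      exact.
    have := ind m.+1 mn C' mC'.
    rewrite !big_ord_recr/= /C' eqxx.
    under eq_bigr => k _ do rewrite ltn_eqF//.
    under [in RHS]eq_bigr => k _ do rewrite ltn_eqF//.
    by move=> ->; rewrite (ind m (ltnW mn) C).
apply: le_trans (leeD2l _ EFY).
rewrite -!ge0_integralD//; last 2 first.
- by move=> w _; rewrite lee_fin mulr_ge0 ?mulr_ge0 ?expR_ge0.
- by move=> w _; rewrite lee_fin mulr_ge0 ?expR_ge0.
apply: ge0_le_integral => //.
- by move=> w _; rewrite adde_ge0// lee_fin mulr_ge0 ?expR_ge0.
- exact: emeasurable_funD.
- exact: emeasurable_funD.
move=> w _; rewrite -!EFinD lee_fin /F /Y -expRD -mulrDr addrAC.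
have -> : (walk m w - walk_max a m w + X m w = walk m.+1 w - walk_max a m w)%R.
  by rewrite /walk big_ord_recr/= addrAC.
rewrite /=; have [le|lt] := leP (walk m.+1 w) (walk_max a m w); first by rewrite addrAC.
rewrite subrr mulr0 expR0 mul1r.
set x := (walk m.+1 w - walk_max a m w)%R.
have : (th^-1 + x <= expR (th * x) / th)%R.
  rewrite ler_pdivlMr// mulrDl mulVf ?gt_eqF// [(x * th)%R]mulrC.
  exact: expR_ge1Dx.
rewrite /x; lra.
Qed.

(** The exponential term of the potential is nonnegative; dropping it leaves the mean overshoot of
    the running maximum, which serves as [V]. *)
Lemma walk_excess (n : nat) (th a : R) : (0 < th)%R ->
  indep_upto n ->
  (forall k, (k < n)%N -> \int[P]_w (expR (th * X k w))%:E <= 1) ->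
  exists V : T -> R, [/\ measurable_fun setT V, (forall w, 0 <= V w)%R,
    \int[P]_w (V w)%:E <= (expR (- (th * a)) / th)%:E &
    forall m w, (0 < m <= n)%N -> (walk m w - a <= V w)%R].
Proof.
move=> th0 ind mgf; exists (fun w => walk_max a n w - a)%R; split.
- by apply: measurable_funB => //; exact: measurable_walk_max.
- by move=> w; rewrite subr_ge0 walk_max_ge.
- have := walk_potential a th0 ind mgf (leqnn n); apply: le_trans.
  rewrite leeDl// integral_ge0// => w _.
  by rewrite lee_fin mulr_ge0 ?expR_ge0 ?invr_ge0 ?ltW.
- by move=> m w mn; rewrite lerD2r; exact: walk_le_max.
Qed.

End random_walk.

(** * Brownian motion with drift *)

Lemma mutually_independent_ord d (T : measurableType d) (R : realType)
    (P : probability T R) (I : choiceType) (G : I -> set_system T) (m : nat)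
    (f : 'I_m -> I) (E : 'I_m -> set T) :
  injective f -> mutually_independent P G -> (forall k, G (f k) (E k)) ->
  P (\big[setI/setT]_k E k) = (\prod_k P (E k))%E.
Proof.
move=> injf ind GE.
(* Independence is stated for families over the whole index type, so [E] is extended by [setT] off
   the image of [f]. *)
pose E' j := if [pick k | f k == j] is Some k then E k else setT.
have E'f k : E' (f k) = E k.
  rewrite /E'; case: pickP => [j /eqP/injf -> //|/(_ k)]; by rewrite eqxx.
pose s := [seq f k | k <- index_enum 'I_m].
have us : uniq s by rewrite map_inj_uniq// index_enum_uniq.
have sE : perm_eq [fset x in s]%fset s.
  by apply: uniq_perm => // x; rewrite !inE.
have := ind [fset x in s]%fset E'.
rewrite bigcap_fset !(perm_big _ sE)/= !big_map.
under eq_bigr do rewrite E'f.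
move=> ->; first by apply: eq_bigr => k _; rewrite E'f.
move=> j; rewrite !inE => /mapP[k _ ->]; rewrite E'f; exact: GE.
Qed.

Lemma ge0_integral_normal_law d (T : measurableType d) (R : realType)
    (P : probability T R) (Y : {RV P >-> R}) (s : R) (f : R -> \bar R) :
  (forall A : set R, measurable A -> distribution P Y A = normal_prob 0 s A) ->
  measurable_fun [set: R] f -> (forall x, 0 <= f x)%E ->
  (\int[P]_w f (Y w) = \int[normal_prob 0 s]_x f x)%E.
Proof.
move=> law mf f0.
(* [normal_prob] lives on the copy [measurableTypeR R] of the line, so [Y] is repackaged as a map
   into it. *)
have mY : @measurable_fun _ _ T (measurableTypeR R) [set: T] Y.
  by move=> mT A mA; exact: (measurable_funP Y).
pose Y' : {mfun T >-> measurableTypeR R} := @mfun_Sub _ _ T (measurableTypeR R) Y (mem_set mY).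
transitivity (\int[distribution P Y']_x f x)%E.
  by rewrite ge0_integral_distribution.
apply: eq_measure_integral => A mA _; exact: law.
Qed.

Section bm_excess.
Context d (T : measurableType d) (R : realType) (P : probability T R).
Variables (sigma : R) (B : R -> {RV P >-> R}).
Hypotheses (sigma0 : 0 < sigma) (bmB : brownian_motion sigma B).

Lemma bm_mgf (u s t : R) : 0 <= s -> s <= t ->
  (\int[P]_w (expR (u * (B t w - B s w)))%:E =
   (expR (u ^+ 2 * sigma ^+ 2 * (t - s) / 2))%:E)%E.
Proof.
move=> s0; rewrite le_eqVlt => /predU1P[->|st].
  under eq_integral do rewrite subrr mulr0 expR0.
  by rewrite subrr mulr0 mul0r expR0 integral_cst//= probability_setT mule1.
have me : measurable_fun [set: R] (fun x : R => (expR (u * x))%:E).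
  by apply/measurable_EFinP; apply: measurableT_comp => //; exact: mulrl_measurable.
rewrite (@ge0_integral_normal_law _ _ _ P (B t \- B s) _ (fun x => (expR (u * x))%:E) (bm_normal bmB s0 st) me); last first.
  by move=> x; rewrite lee_fin expR_ge0.
rewrite normal_mgf; last by rewrite mulr_gt0// sqrtr_gt0 subr_gt0.
by rewrite exprMn sqr_sqrtr ?subr_ge0 ?(ltW st)// mulrA.
Qed.

(* [rho] and [eps] allow the increments to be read backwards in time. *)
Lemma bm_walk_excess (t : nat -> R) (n : nat) (rho : nat -> nat) (eps c a : R) :
  0 <= t 0%N -> {homo t : m n / (m <= n)%N >-> m <= n} ->
  {in [pred k | (k < n)%N] &, injective rho} -> eps ^+ 2 = 1 -> 0 < c ->
  exists V : T -> R, [/\ measurable_fun setT V, (forall w, 0 <= V w),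
    (\int[P]_w (V w)%:E <=
       (expR (- (2 * c / sigma ^+ 2 * a)) / (2 * c / sigma ^+ 2))%:E)%E &
    forall m w, (0 < m <= n)%N ->
      \sum_(k < m) (eps * (B (t (rho k).+1) w - B (t (rho k)) w)
                    - c * (t (rho k).+1 - t (rho k))) - a <= V w].
Proof.
move=> t0 tnd rinj eps1 c0.
pose X k w := eps * (B (t (rho k).+1) w - B (t (rho k)) w)
                    - c * (t (rho k).+1 - t (rho k)).
have tge0 k : 0 <= t k by rewrite (le_trans t0)// tnd.
have mX k : measurable_fun setT (X k).
  apply: measurable_funB => //; apply: measurable_funM => //.
  exact: measurable_funB.
(* At this exponent a Gaussian increment with drift [- c] has exponential moment exactly 1, whatever
   its duration. *)
have th0 : 0 < 2 * c / sigma ^+ 2 by rewrite divr_gt0 ?mulr_gt0 ?exprn_gt0.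
apply: (@walk_excess _ _ _ P X mX n _ a th0).
- move=> m mn C mC.
  apply: (@mutually_independent_ord _ _ _ _ _ _ _ (fun k : 'I_m => rho k) _ _ (bm_increments bmB t0 tnd)).
    move=> j k /rinj jk; apply: val_inj; apply: jk; rewrite !inE; exact: leq_trans (ltn_ord _) mn.
  move=> k; exists ((fun x => eps * x - c * (t (rho k).+1 - t (rho k))) @^-1` C k).
    have : measurable_fun [set: R] (fun x => eps * x - c * (t (rho k).+1 - t (rho k))).
      by apply: measurable_funB => //; exact: mulrl_measurable.
    by move=> /(_ measurableT _ (mC k)); rewrite setTI.
  by rewrite setTI.
- move=> k kn; set u := 2 * c / sigma ^+ 2.
  pose D := t (rho k).+1 - t (rho k).
  under eq_integral => w _.
    rewrite /X mulrBr [u * (eps * _)]mulrA expRD EFinM; over.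
  have me : measurable_fun setT (fun w => (expR (u * eps * (B (t (rho k).+1) w - B (t (rho k)) w)))%:E).
    apply/measurable_EFinP; apply: measurableT_comp => //; apply: measurable_funM => //.
    exact: measurable_funB.
  rewrite ge0_integralZr//.
  rewrite bm_mgf//; last exact: tnd.
  rewrite -EFinM -expRD lee_fin -/D.
  rewrite (_ : _ + _ = 0) ?expR0// exprMn eps1 mulr1 /u.
  have ? : sigma != 0 by rewrite gt_eqF.
  by field.
Qed.

Lemma sorted_grid (l : seq R) : l != [::] ->
  exists t : nat -> R, [/\ {homo t : m n / (m <= n)%N >-> m <= n},
    forall k, t k \in l & forall x, x \in l -> exists2 j, (j < size l)%N & t j = x].
Proof.
move=> l0; pose s := sort <=%R l.
have ss : size s = size l by rewrite size_sort.
have s0 : (0 < size s)%N by rewrite ss; case: (l) l0.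
(* Clamping the index at the last entry extends the sorted list to a nondecreasing sequence on all
   of [nat], as [bm_increments] demands. *)
pose t k := nth 0 s (minn k (size s).-1).
have ms k : (minn k (size s).-1 < size s)%N.
  by rewrite (leq_ltn_trans (geq_minr _ _))// prednK.
exists t; split.
- move=> j k jk; apply: (@sorted_leq_nth _ <=%R) => //; rewrite ?inE//.
  + exact: le_trans.
  + by apply: sort_sorted => x y; exact: le_total.
  + by rewrite leq_min geq_minr andbT (leq_trans (geq_minl _ _)).
- by move=> k; rewrite -(mem_sort <=%R) mem_nth.
- move=> x; rewrite -(mem_sort <=%R) -/s => xs; exists (index x s).
    by rewrite -ss index_mem.
  rewrite /t (minn_idPl _) ?nth_index// -ltnS prednK// index_mem//.
Qed.

Let th c := 2 * c / sigma ^+ 2.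

Lemma bm_excess_forward (l : seq R) (s0 c a : R) : 0 <= s0 -> 0 < c -> 0 <= a ->
  (forall x, x \in l -> s0 <= x) ->
  exists V : T -> R, [/\ measurable_fun setT V, (forall w, 0 <= V w),
    (\int[P]_w (V w)%:E <= (expR (- (th c * a)) / th c)%:E)%E &
    forall x w, x \in l -> B x w - B s0 w - c * (x - s0) - a <= V w].
Proof.
move=> s00 c0 a0 ls0.
have [t [tnd tl lt]] := @sorted_grid (s0 :: l) isT.
have ts0 k : s0 <= t k by have := tl k; rewrite inE => /predU1P[->//|]; exact: ls0.
have t0E : t 0%N = s0.
  by have [j _ tj] := lt s0 (mem_head _ _); apply/eqP; rewrite eq_le ts0 andbT -tj tnd.
have t00 : 0 <= t 0%N by rewrite t0E.
have idinj : {in [pred k | (k < size l)%N] &, injective (@id nat)} by [].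
have [V [mV V0 iV HV]] := bm_walk_excess a t00 tnd idinj (expr1n _ _) c0.
exists V; split => // x w xl.
have [|j jl tj] := lt x; first by rewrite inE xl orbT.
case: j jl tj => [_ tx|j jl tj].
  by rewrite -tx t0E !subrr mulr0 subrr sub0r (le_trans _ (V0 w))// oppr_le0.
have := HV j.+1 w; rewrite /= -ltnS jl => /(_ isT); apply: le_trans.
rewrite lerD2r le_eqVlt; apply/orP; left; apply/eqP.
(* The walk telescopes to the drifted displacement from [s0], the first point of the grid. *)
pose g k := B (t k) w - c * t k.
transitivity (\sum_(0 <= k < j.+1) (g k.+1 - g k)).
  by rewrite telescope_sumr// /g t0E tj; lra.
by rewrite big_mkord; apply: eq_bigr => k _; rewrite /g; lra.
Qed.

Lemma bm_excess_backward (l : seq R) (s0 c a : R) : 0 <= s0 -> 0 < c -> 0 <= a ->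
  (forall x, x \in l -> 0 <= x <= s0) ->
  exists V : T -> R, [/\ measurable_fun setT V, (forall w, 0 <= V w),
    (\int[P]_w (V w)%:E <= (expR (- (th c * a)) / th c)%:E)%E &
    forall x w, x \in l -> B x w - B s0 w - c * (s0 - x) - a <= V w].
Proof.
move=> s00 c0 a0 ls0.
have [t [tnd tl lt]] := @sorted_grid (s0 :: l) isT.
have ts0 k : 0 <= t k <= s0.
  by have := tl k; rewrite inE => /predU1P[->|]; [rewrite s00 lexx|exact: ls0].
set n := size l.
have tnE : t n = s0.
  have [j jn tj] := lt s0 (mem_head _ _); apply/eqP; rewrite eq_le -{2}tj tnd//.
  by case/andP: (ts0 n) => _ ->.
have t00 : 0 <= t 0%N by case/andP: (ts0 0%N).
(* Here [s0] is the last point [t n] of the grid: the increments are taken from the last to the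
   first, with [eps = -1]. *)
have revinj : {in [pred k | (k < n)%N] &, injective (fun k => n.-1 - k)%N}.
  by move=> j k; rewrite !inE => jn kn; lia.
have N1 : (-1 : R) ^+ 2 = 1 by rewrite sqrrN expr1n.
have [V [mV V0 iV HV]] := bm_walk_excess a t00 tnd revinj N1 c0.
exists V; split => // x w xl.
have [|j jl tj] := lt x; first by rewrite inE xl orbT.
have [jn|jn] := eqVneq j n.
  by rewrite -tj jn tnE !subrr mulr0 subrr sub0r (le_trans _ (V0 w))// oppr_le0.
have jn' : (j < n)%N by rewrite ltn_neqAle jn -ltnS.
have := HV (n - j)%N w; rewrite subn_gt0 jn' leq_subr => /(_ isT); apply: le_trans.
rewrite lerD2r le_eqVlt; apply/orP; left; apply/eqP.
pose g k := B (t (n - k)%N) w + c * t (n - k)%N.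
transitivity (\sum_(0 <= k < n - j) (g k.+1 - g k)).
  by rewrite telescope_sumr// /g subn0 tnE subKn ?(ltnW jn')// tj; lra.
rewrite big_mkord; apply: eq_bigr => k _; rewrite /g.
have kn : (k < n)%N by rewrite (leq_trans (ltn_ord k))// leq_subr.
have -> : (n.-1 - k).+1 = (n - k)%N by lia.
have -> : (n.-1 - k)%N = (n - k.+1)%N by lia.
lra.
Qed.

(** The times after and before [s0] are treated by the two preceding bounds; adding the two
    overshoots gives the factor 2. *)
Lemma bm_excess_list (l : seq R) (s0 c a : R) : 0 <= s0 -> 0 < c -> 0 <= a ->
  (forall x, x \in l -> 0 <= x) ->
  exists V : T -> R, [/\ measurable_fun setT V, (forall w, 0 <= V w),
    (\int[P]_w (V w)%:E <= (2 * (expR (- (th c * a)) / th c))%:E)%E &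
    forall x w, x \in l -> B x w - B s0 w - c * `|x - s0| - a <= V w].
Proof.
move=> s00 c0 a0 l0.
have [|V [mV V0 iV HV]] := @bm_excess_forward [seq x <- l | s0 <= x] s0 c a s00 c0 a0.
  by move=> x; rewrite mem_filter => /andP[].
have [|U [mU U0 iU HU]] := @bm_excess_backward [seq x <- l | x <= s0] s0 c a s00 c0 a0.
  by move=> x; rewrite mem_filter => /andP[-> /l0 ->].
exists (fun w => V w + U w); split.
- exact: measurable_funD.
- by move=> w; rewrite addr_ge0.
- under eq_integral do rewrite EFinD.
  rewrite ge0_integralD//; [|by move=> w _; rewrite lee_fin|exact/measurable_EFinP|by move=> w _; rewrite lee_fin|exact/measurable_EFinP].
  by rewrite mulr_natl mulr2n EFinD leeD.
- move=> x w xl; have [s0x|xs0] := leP s0 x.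
    rewrite ger0_norm ?subr_ge0// ler_wpDr// HV// mem_filter s0x//.
  rewrite distrC ger0_norm ?subr_ge0 ?(ltW xs0)// ler_wpDl// HU// mem_filter (ltW xs0)//.
Qed.

(** The bound for finite lists is uniform in their length, so monotone convergence extends it to
    countably many times. *)
Lemma bm_excess_seq (s : nat -> R) (s0 c a : R) : 0 <= s0 -> 0 < c -> 0 <= a ->
  (forall k, 0 <= s k) ->
  exists Z : T -> \bar R, [/\ measurable_fun setT Z, (forall w, 0 <= Z w)%E,
    (\int[P]_w Z w <= (2 * (expR (- (th c * a)) / th c))%:E)%E &
    forall k w, ((B (s k) w - B s0 w - c * `|s k - s0| - a)%:E <= Z w)%E].
Proof.
move=> s00 c0 a0 sk0.
pose f k w := B (s k) w - B s0 w - c * `|s k - s0| - a.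
have mf k : measurable_fun setT (f k).
  by do 2 (apply: measurable_funB => //); exact: measurable_funB.
(* Starting the running maximum at 0 keeps it nonnegative and still below each nonnegative [V]. *)
pose E n w : \bar R := (iteri n (fun k r => Num.max r (f k w)) 0)%:E.
have mE n : measurable_fun setT (E n).
  apply/measurable_EFinP; elim: n => [|n ih].
    exact: measurable_cst.
  exact: measurable_maxr.
have E0 n w : (0 <= E n w)%E.
  by rewrite lee_fin; elim: n => //= n ih; rewrite le_max ih.
have ndE w : {homo E^~ w : m n / (m <= n)%N >-> (m <= n)%E}.
  apply/nondecreasing_seqP => n.
  by rewrite lee_fin /= le_max lexx.
exists (fun w => limn (E^~ w)); split.
- apply: (emeasurable_fun_cvg E) => // w _; exact: ereal_nondecreasing_is_cvgn.
- move=> w; apply: lime_ge; first exact: ereal_nondecreasing_is_cvgn.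
  exact: nearW.
- rewrite monotone_convergence//; apply: lime_le.
    apply: ereal_nondecreasing_is_cvgn => m n mn; apply: ge0_le_integral => // w _.
    exact: ndE.
  apply: nearW => n.
  have [|V [mV V0 iV HV]] := @bm_excess_list [seq s k | k <- iota 0 n] s0 c a s00 c0 a0.
    by move=> x /mapP[k _ ->].
  apply: le_trans iV; apply: ge0_le_integral => //; first exact/measurable_EFinP.
  move=> w _; rewrite lee_fin.
  have fV k : (k < n)%N -> f k w <= V w.
    by move=> kn; apply: HV; apply: map_f; rewrite mem_iota add0n.
  elim: (n) fV => [|m ih] fV /=; first exact: V0.
  by rewrite ge_max fV// ih// => k km; apply: fV; exact: ltnW.
- move=> k w; apply: (@le_trans _ _ (E k.+1 w)).
    by rewrite lee_fin /= le_max lexx orbT.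
  have /cvg_lim -> // := ereal_nondecreasing_cvgn (ndE w).
  by apply: ereal_sup_ubound; exists k.+1.
Qed.
End bm_excess.

(** * Workloads and their maximum *)

Section ae_integral.
Context d (T : measurableType d) (R : realType) (mu : {measure set T -> \bar R}).
Local Open Scope ereal_scope.
Import HBNNSimple.

(** A simple function below [f], cut off outside [A], keeps its integral and lies below [g]. *)
Let ge0_le_integral_off_null (A : set T) (f g : T -> \bar R) :
  measurable A -> mu (~` A) = 0 -> (forall x, 0 <= f x) -> (forall x, 0 <= g x) ->
  (forall x, A x -> f x = g x) -> \int[mu]_x f x <= \int[mu]_x g x.
Proof.
move=> mA muA f0 g0 fg.
rewrite (ge0_integralTE _ f0) (ge0_integralTE _ g0).
apply: ge_ereal_sup => _ [h /= hf <-].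
rewrite -integralT_nnsfun.
apply: (@le_trans _ _ (\int[mu]_x (proj_nnsfun h mA x)%:E)).
  rewrite le_eqVlt; apply/orP; left; apply/eqP; apply: ae_eq_integral => //.
  - exact/measurable_EFinP.
  - exact/measurable_EFinP.
  exists (~` A); split => //; first exact: measurableC.
  move=> x /= hx Ax; apply: hx => _.
  by rewrite /= mindicE mem_set// mulr1.
rewrite integralT_nnsfun; apply: ereal_sup_ubound; exists (proj_nnsfun h mA) => //= x.
rewrite /= mindicE; have [Ax|nAx] := boolP (x \in A); rewrite ?mulr1 ?mulr0//.
by rewrite -fg ?hf//; apply/set_mem.
Qed.

(* On a nonmeasurable nonnegative function, the integral of the library is the
   lower integral, which ignores null sets. *)
Lemma ae_eq_integral_nonmeasurable (f g : T -> \bar R) :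
  {ae mu, forall x, f x = g x} -> \int[mu]_x f x = \int[mu]_x g x.
Proof.
move=> [N [mN muN fgN]].
have fg x : (~` N) x -> f x = g x.
  by move=> Nx; apply: contrapT => fgx; apply: Nx; exact: fgN.
have mA : measurable (~` N) by exact: measurableC.
have muA : mu (~` (~` N)) = 0 by rewrite setCK.
rewrite integralE [RHS]integralE; congr (_ - _); apply/eqP; rewrite eq_le; apply/andP; split;
  apply: (ge0_le_integral_off_null mA muA) => // x Nx;
  by rewrite ?funeposE ?funenegE (fg _ Nx).
Qed.

End ae_integral.

(** * Measurable versions of the workloads and the upper bound on their maximum *)

Section queueing.
Context d (T : measurableType d) (R : realType) (P : probability T R).
Variables (sigma sigmaA : R) (W : nat -> R -> {RV P >-> R}) (WA : R -> {RV P >-> R}).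
Hypotheses (sigma0 : 0 < sigma) (sigmaA0 : 0 < sigmaA).
Hypotheses (bmW : forall j, brownian_motion sigma (W j)) (bmA : brownian_motion sigmaA WA).

(** An enumeration of a countable dense set of positive times; codes that give no positive rational
    are sent to 1. *)
Definition pos_rat (k : nat) : R :=
  if choice.unpickle k is Some r then (if 0 < (ratr r : R) then ratr r else 1) else 1.

Lemma pos_rat_gt0 k : 0 < pos_rat k.
Proof. by rewrite /pos_rat; case: (choice.unpickle k) => // r; case: ifPn. Qed.

Lemma pos_rat_dense (x y : R) : 0 <= x -> x < y -> exists k, x < pos_rat k < y.
Proof.
move=> x0 /rat_in_itvoo[r]; rewrite in_itv/= => /andP[xr ry].
by exists (choice.pickle r); rewrite /pos_rat choice.pickleK (le_lt_trans x0 xr) xr ry.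
Qed.

Definition net (j : nat) (s : R) (w : T) : R := W j s w + WA s w - s.

(** The almost sure event, common to all queues, on which the pathwise arguments take place. *)
Definition regular (w : T) : Prop :=
  (forall j, W j 0 w = 0 /\ {within `[0, +oo[, continuous (fun t => W j t w)}) /\
  WA 0 w = 0 /\ {within `[0, +oo[, continuous (fun t => WA t w)}.

Lemma ae_regular : {ae P, forall w, regular w}.
Proof.
have HW : {ae P, forall w, forall j, W j 0 w = 0 /\ {within `[0, +oo[, continuous (fun t => W j t w)}}.
  apply: ae_foralln => j.
  by apply: filterS2 (bm_start (bmW j)) (bm_continuous (bmW j)).
apply: filterS3 HW (bm_start bmA) (bm_continuous bmA) => w ? ? ?.
by split.
Qed.

Lemma continuous_right_limit (f : R -> R) (s : R) :
  {within `[0, +oo[, continuous f} -> 0 <= s -> f x @[x --> s^'+] --> f s.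
Proof.
move=> /continuous_within_itvcyP[cf f0]; rewrite le_eqVlt => /predU1P[<-//|s0].
by apply: cvg_at_right_filter; apply: cf; rewrite in_itv/= s0.
Qed.

(** By right continuity a value above [u] at time [s] would persist just after [s], where there is a
    positive rational. Working from the right covers [s = 0] as well. *)
Lemma net_le_pos_rat j w (u : \bar R) s : regular w -> 0 <= s ->
  (forall k, ((net j (pos_rat k) w)%:E <= u)%E) -> ((net j s w)%:E <= u)%E.
Proof.
move=> [regW [_ cA]] s0 ub.
case: u ub => [u| |] ub; [|by rewrite leey|by have := ub 0%N].
rewrite lee_fin leNgt; apply/negP => us.
have cn : net j x w @[x --> s^'+] --> net j s w.
  apply: cvgB; last by apply: cvg_at_right_filter; exact: cvg_id.
  by apply: cvgD; apply: continuous_right_limit => //; have [] := regW j.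
have /(_ _)[] := @cvgr_gt _ _ _ _ _ _ cn u us.
move=> e e0 He.
have [k /andP[sk ke]] := @pos_rat_dense s (s + e) s0 (ltr_pwDr e0 (lexx _)).
have := He (pos_rat k); rewrite /ball/= distrC ger0_norm ?subr_ge0 ?(ltW sk)//.
rewrite ltrBlDl ke => /(_ isT sk); rewrite /= ltNge -lee_fin.
by rewrite ub.
Qed.

(** A countable supremum, hence measurable, that coincides with [queue] on regular paths; [esups] at
    0 ranges over the whole sequence. *)
Definition queue_sup (j : nat) (w : T) : \bar R :=
  esups (fun k => (net j (pos_rat k) w)%:E) 0.

Lemma measurable_net j s : measurable_fun setT (net j s).
Proof. by apply: measurable_funB => //; exact: measurable_funD. Qed.

Lemma measurable_queue_sup j : measurable_fun setT (queue_sup j).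
Proof.
by apply: measurable_fun_esups => k; apply/measurable_EFinP; exact: measurable_net.
Qed.

Lemma queue_sup_ub j w k : ((net j (pos_rat k) w)%:E <= queue_sup j w)%E.
Proof. by apply: ereal_sup_ubound; exists k. Qed.

Lemma queue_sup_le j w u : (forall k, ((net j (pos_rat k) w)%:E <= u)%E) ->
  (queue_sup j w <= u)%E.
Proof. by move=> ub; apply: ge_ereal_sup => _ [k _ <-]. Qed.

Lemma queueE j w : regular w -> queue W WA j w = queue_sup j w.
Proof.
move=> reg; apply/eqP; rewrite eq_le; apply/andP; split.
  apply: ge_ereal_sup => _ [s /= s0 <-].
  by apply: (net_le_pos_rat reg (ltW s0)) => k; exact: queue_sup_ub.
apply: queue_sup_le => k; apply: ereal_sup_ubound.
by exists (pos_rat k) => //; exact: pos_rat_gt0.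
Qed.

Lemma net_le_queue_sup j w s : regular w -> 0 <= s -> ((net j s w)%:E <= queue_sup j w)%E.
Proof. by move=> reg s0; apply: net_le_pos_rat => // k; exact: queue_sup_ub. Qed.

Lemma queue_sup_ge0 j w : regular w -> (0 <= queue_sup j w)%E.
Proof.
move=> reg; have := net_le_queue_sup j reg (lexx 0); apply: le_trans.
by rewrite /net subr0; have [regW [-> _]] := reg; have [-> _] := regW j; rewrite addr0.
Qed.

(** Half of the unit drift is given to [W j] and half to [WA]; each drifted motion then has an
    integrable supremum. *)
Lemma queue_sup_dominated j : exists Z : T -> \bar R,
  [/\ P.-integrable setT Z, (forall w, 0 <= Z w)%E &
    forall w, regular w -> (queue_sup j w <= Z w)%E].
Proof.
have h0 : (0 : R) < 2^-1 by rewrite invr_gt0.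
have q0 k : 0 <= pos_rat k by exact/ltW/pos_rat_gt0.
have [Z1 [mZ1 Z10 iZ1 HZ1]] := bm_excess_seq sigma0 (bmW j) (lexx 0) h0 (lexx 0) q0.
have [Z2 [mZ2 Z20 iZ2 HZ2]] := bm_excess_seq sigmaA0 bmA (lexx 0) h0 (lexx 0) q0.
exists (fun w => Z1 w + Z2 w)%E; split.
- apply: integrableD => //; apply/integrableP; split => //.
    under eq_integral do rewrite gee0_abs//.
    by rewrite (le_lt_trans iZ1)// ltry.
  under eq_integral do rewrite gee0_abs//.
  by rewrite (le_lt_trans iZ2)// ltry.
- by move=> w; rewrite adde_ge0.
- move=> w [regW [A0 _]]; have [W0 _] := regW j.
  apply: queue_sup_le => k; apply: le_trans (leeD (HZ1 k w) (HZ2 k w)).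
  rewrite -EFinD lee_fin /net W0 A0 !subr0 ger0_norm//.
  lra.
Qed.

Definition queue_real (j : nat) (w : T) : R := fine (queue_sup j w).

Lemma measurable_queue_real j : measurable_fun setT (queue_real j).
Proof. by apply: measurableT_comp => //; exact: measurable_queue_sup. Qed.

Lemma ae_queue_sup_fin j :
  {ae P, forall w, regular w /\ queue_sup j w = (queue_real j w)%:E}.
Proof.
have [Z [iZ Z0 HZ]] := queue_sup_dominated j.
have Zfin := integrable_ae measurableT iZ.
apply: filterS2 ae_regular Zfin => w reg /(_ I) Zw; split => //.
rewrite /queue_real fineK// ge0_fin_numE ?queue_sup_ge0//.
by apply: le_lt_trans (HZ w reg) _; rewrite -ge0_fin_numE.
Qed.

Lemma integrable_queue_real j : P.-integrable setT (EFin \o queue_real j).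
Proof.
have [Z [iZ Z0 HZ]] := queue_sup_dominated j.
apply/integrableP; split; first by apply/measurable_EFinP; exact: measurable_queue_real.
have /integrableP[mZ] := iZ; apply: le_lt_trans.
apply: ae_ge0_le_integral => //.
- apply: measurableT_comp => //; apply/measurable_EFinP; exact: measurable_queue_real.
- exact: measurableT_comp.
apply: filterS (ae_queue_sup_fin j) => w [reg E] _.
have -> : (EFin \o queue_real j) w = queue_sup j w by rewrite /= E.
by rewrite !gee0_abs ?queue_sup_ge0// HZ.
Qed.

(** Starting from 0 instead of [-oo] is harmless, as workloads are almost surely nonnegative, and
    makes the maximum nonnegative everywhere. *)
Definition max_queue_real (N : nat) (w : T) : R :=
  iteri N (fun j r => Num.max r (queue_real j w)) 0.

Lemma measurable_max_queue_real N : measurable_fun setT (max_queue_real N).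
Proof.
elim: N => [|N ih]; first exact: measurable_cst.
by apply: measurable_maxr => //; exact: measurable_queue_real.
Qed.

Lemma max_queue_real_ge0 N w : 0 <= max_queue_real N w.
Proof. by elim: N => //= N ih; rewrite le_max ih. Qed.

Lemma le_max_queue_real N w j : (j < N)%N -> queue_real j w <= max_queue_real N w.
Proof.
elim: N => // N ih; rewrite ltnS leq_eqVlt => /predU1P[->|/ih h];
  by rewrite /max_queue_real /= le_max ?lexx ?orbT// h.
Qed.

Lemma max_queue_real_le N w u : 0 <= u -> (forall j, (j < N)%N -> queue_real j w <= u) ->
  max_queue_real N w <= u.
Proof.
move=> u0; elim: N => // N ih ub; rewrite /max_queue_real /= ge_max ub// andbT.
by apply: ih => j jN; apply: ub; exact: ltnW.
Qed.

Lemma integrable_max_queue_real N : P.-integrable setT (EFin \o max_queue_real N).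
Proof.
have h : P.-integrable setT (fun w => \sum_(j < N) `|(queue_real j w)%:E|)%E.
  by apply: integrable_sum => // j _; apply: integrable_abse; exact: integrable_queue_real.
apply: (le_integrable _ _ _ h) => //.
  by apply/measurable_EFinP; exact: measurable_max_queue_real.
move=> w _; rewrite /= (@gee0_abs _ (\sum_(j < N) _)%E) ?sume_ge0//.
rewrite ger0_norm ?max_queue_real_ge0// sumEFin lee_fin.
apply: max_queue_real_le; first exact: sumr_ge0.
move=> j jN; rewrite (bigD1 (Ordinal jN))//= ler_wpDr ?sumr_ge0//.
exact: ler_norm.
Qed.

Lemma ae_max_queue N : (0 < N)%N ->
  {ae P, forall w, [/\ regular w, (forall j, queue_sup j w = (queue_real j w)%:E),
    (forall j, queue W WA j w = (queue_real j w)%:E) &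
    max_queue W WA N w = (max_queue_real N w)%:E]}.
Proof.
move=> N0; have := ae_foralln ae_queue_sup_fin; apply: filterS => w H.
have reg : regular w by have [] := H 0%N.
have HS j : queue_sup j w = (queue_real j w)%:E by have [] := H j.
have HQ j : queue W WA j w = (queue_real j w)%:E by rewrite queueE.
split => //; rewrite /max_queue; apply/eqP; rewrite eq_le; apply/andP; split.
  apply/bigmax_leP; split => [|j _]; first exact: leNye.
  by rewrite HQ lee_fin le_max_queue_real.
have Q0 j : 0 <= queue_real j w by rewrite -lee_fin -HS queue_sup_ge0.
have Qmax j (jN : (j < N)%N) : ((queue_real j w)%:E <= \big[maxe/-oo]_(j < N) queue W WA j w)%E.
  by rewrite -HQ; exact: (le_bigmax _ (fun j : 'I_N => queue W WA j w) (Ordinal jN)).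
suff : forall n, (n <= N)%N ->
  ((max_queue_real n w)%:E <= \big[maxe/-oo]_(j < N) queue W WA j w)%E by exact.
elim=> [_|n ih nN]; first by apply: le_trans (Qmax 0%N N0); rewrite lee_fin.
by rewrite /max_queue_real /= EFin_max ge_max Qmax// ih// ltnW.
Qed.

(* The tangent cones of slopes [1 - eta] and [1 + eta] to the barrier
   [sigma * sqrt (2 * ln N * s)] are each crossed by a given [W j] with
   probability [1 / N], and they leave [eta * `|x - s|] for the increments of
   [WA] around [s]. *)
Lemma max_queue_upper (N : nat) (s eta : R) : (2 <= N)%N ->
  s = sigma ^+ 2 / 2 * ln N%:R -> 0 < eta -> eta <= 2^-1 ->
  exists Z : T -> \bar R, [/\ measurable_fun setT Z, (forall w, 0 <= Z w)%E,
    (\int[P]_w Z w <= (4 * sigma ^+ 2 + sigmaA ^+ 2 / eta + 2 * s * eta ^+ 2)%:E)%E &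
    {ae P, forall w, ((max_queue_real N w - (s + WA s w))%:E <= Z w)%E}].
Proof.
move=> N2 sE eta0 eta1.
have N0 : (0 < N)%N by exact: leq_trans N2.
have lnN : 0 < ln (N%:R : R) by rewrite ln_gt0// ltr1n.
have s0 : 0 < s by rewrite sE mulr_gt0// divr_gt0// exprn_gt0.
have q0 k : 0 <= pos_rat k by exact/ltW/pos_rat_gt0.
(* The barrier is [2 * sqrt (s * x)], and its tangent of slope [c] has intercept [s / c]. The
   exponent [2 * c / sigma ^+ 2] times this intercept is [ln N], so each queue contributes at most
   [sigma ^+ 2 / (c * N)] in mean. *)
have cone c : 2^-1 <= c -> exists Z : nat -> T -> \bar R, [/\
    forall j, measurable_fun setT (Z j), (forall j w, 0 <= Z j w)%E,
    (forall j, \int[P]_w Z j w <= (2 * sigma ^+ 2 / N%:R)%:E)%E &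
    forall j k w, ((W j (pos_rat k) w - W j 0 w - c * pos_rat k - s / c)%:E <= Z j w)%E].
  move=> c1; have c0 : 0 < c by apply: lt_le_trans c1; rewrite invr_gt0.
  have sc0 : 0 <= s / c by rewrite divr_ge0 ?ltW.
  have /choice[Z HZ] : forall j, exists Z : T -> \bar R, [/\
      measurable_fun setT Z, (forall w, 0 <= Z w)%E,
      (\int[P]_w Z w <= (2 * sigma ^+ 2 / N%:R)%:E)%E &
      forall k w, ((W j (pos_rat k) w - W j 0 w - c * pos_rat k - s / c)%:E <= Z w)%E].
    move=> j.
    have [Z [mZ Z0 iZ HZ]] := bm_excess_seq sigma0 (bmW j) (lexx 0) c0 sc0 q0.
    exists Z; split => //; last first.
      by move=> k w; have := HZ k w; rewrite subr0 (ger0_norm (q0 k)).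
    apply: le_trans iZ _; rewrite lee_fin.
    have -> : 2 * c / sigma ^+ 2 * (s / c) = ln N%:R.
      by rewrite sE; field; rewrite !gt_eqF.
    have Nn0 : (N%:R : R) != 0 by rewrite pnatr_eq0 -lt0n.
    rewrite expRN lnK ?posrE ?ltr0n//.
    have -> : 2 * (N%:R^-1 / (2 * c / sigma ^+ 2)) = sigma ^+ 2 / N%:R * c^-1.
      by field; rewrite ?Nn0 !gt_eqF.
    have -> : 2 * sigma ^+ 2 / N%:R = sigma ^+ 2 / N%:R * 2 by ring.
    rewrite ler_wpM2l ?divr_ge0 ?sqr_ge0//.
    by rewrite -[leRHS]invrK lef_pV2 ?posrE ?invr_gt0.
  by exists Z; split => [j|j w|j|j k w]; have [] := HZ j.
have [Z1 [mZ1 Z10 iZ1 HZ1]] : exists Z : nat -> T -> \bar R, _ := cone (1 - eta) ltac:(lra).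
have [Z2 [mZ2 Z20 iZ2 HZ2]] : exists Z : nat -> T -> \bar R, _ := cone (1 + eta) ltac:(lra).
have [U [mU U0 iU HU]] := bm_excess_seq sigmaA0 bmA (ltW s0) eta0 (lexx 0) q0.
have K0 : 0 <= 2 * s * eta ^+ 2 by rewrite !mulr_ge0 ?sqr_ge0 ?ltW.
(* The sum dominates every single overshoot: two cones and [N] queues at [2 * sigma ^+ 2 / N] each
   make up [4 * sigma ^+ 2]. *)
pose S w := (\sum_(j < N) (Z1 j w + Z2 j w))%E.
have S0 w : (0 <= S w)%E by apply: sume_ge0 => j _; rewrite adde_ge0.
have mS : measurable_fun setT S.
  by apply: emeasurable_sum => j; exact: emeasurable_funD.
have mSU : measurable_fun setT (fun w => S w + U w)%E by exact: emeasurable_funD.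
exists (fun w => S w + U w + (2 * s * eta ^+ 2)%:E)%E; split.
- exact: emeasurable_funD.
- by move=> w; rewrite !adde_ge0.
- rewrite ge0_integralD//; [|by move=> w _; rewrite adde_ge0].
  rewrite ge0_integralD// integral_cst//= probability_setT mule1 EFinD leeD2r//.
  rewrite EFinD leeD//.
    rewrite /S ge0_integral_sum//; last 2 first.
      by move=> j; exact: emeasurable_funD.
      by move=> j w _; rewrite adde_ge0.
    have -> : (4 * sigma ^+ 2 = \sum_(j < N) 2 * (2 * sigma ^+ 2 / N%:R))%R.
      rewrite sumr_const card_ord -mulr_natl.
      have Nn0 : (N%:R : R) != 0 by rewrite pnatr_eq0 -lt0n.
      by field.
    rewrite -sumEFin; apply: lee_sum => j _.
    rewrite ge0_integralD// mulr_natl mulr2n EFinD leeD//.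
  apply: le_trans iU _; rewrite lee_fin mulr0 oppr0 expR0.
  have -> // : 2 * (1 / (2 * eta / sigmaA ^+ 2)) = sigmaA ^+ 2 / eta.
  by field; rewrite !gt_eqF.
- apply: filterS (ae_max_queue N0) => w [reg HS _ _].
  set Z := (_ + _ + _)%E.
  have key j k : (j < N)%N -> ((net j (pos_rat k) w - (s + WA s w))%:E <= Z)%E.
    move=> jN; have [regW _] := reg; have [W0 _] := regW j.
    set x := pos_rat k.
    have SZ : (Z1 j w + Z2 j w <= S w)%E.
      by rewrite /S (bigD1 (Ordinal jN))//= leeDl// sume_ge0// => ? _; rewrite adde_ge0.
    have SZ1 : (Z1 j w <= S w)%E by apply: le_trans SZ; rewrite leeDl.
    have SZ2 : (Z2 j w <= S w)%E by apply: le_trans SZ; rewrite leeDr.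
    have h1 := HZ1 j k w; have h2 := HZ2 j k w; have hU := HU k w.
    rewrite -/x W0 subr0 in h1 h2; rewrite -/x subr0 in hU.
    have eta'0 : 0 < 1 - eta by lra.
    have eta''0 : 0 < 1 + eta by lra.
    (* On either side of [s] the slope of the cone and the drift lent to [WA] add up to the unit
       drift. What remains, [s / (1 - eta) - eta * s] or [s / (1 + eta) + eta * s], exceeds [s] by
       at most [2 * s * eta ^+ 2]; the former uses [eta <= 1 / 2]. *)
    have [sx|xs] := leP s x.
      rewrite ger0_norm ?subr_ge0// in hU.
      apply: le_trans (leeD (leeD (le_trans h1 SZ1) hU) (lexx _)).
      rewrite -!EFinD lee_fin /net.
      have : s / (1 - eta) <= s + eta * s + 2 * s * eta ^+ 2.
        rewrite ler_pdivrMr//.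
        have : 0 <= s * eta ^+ 2 * (1 - 2 * eta).
          by rewrite mulr_ge0 ?mulr_ge0 ?sqr_ge0 ?(ltW s0)//; lra.
        lra.
      lra.
    rewrite distrC ger0_norm ?subr_ge0 ?(ltW xs)// in hU.
    apply: le_trans (leeD (leeD (le_trans h2 SZ2) hU) (lexx _)).
    rewrite -!EFinD lee_fin /net.
    have : s / (1 + eta) <= s - eta * s + 2 * s * eta ^+ 2.
      rewrite ler_pdivrMr//.
      have : 0 <= s * eta ^+ 2 * (1 + 2 * eta).
        by rewrite mulr_ge0 ?mulr_ge0 ?sqr_ge0 ?(ltW s0)//; lra.
      lra.
    lra.
  have keyQ j : (j < N)%N -> ((queue_real j w)%:E <= Z + (s + WA s w)%:E)%E.
    move=> jN; rewrite -HS; apply: queue_sup_le => k.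
    by rewrite -leeBlDr// -EFinB; exact: key.
  (* The maximum starts at 0, so its upper bound has to be nonnegative too. *)
  have Z'0 : (0 <= Z + (s + WA s w)%:E)%E.
    by apply: le_trans (keyQ 0%N N0); rewrite -HS queue_sup_ge0.
  rewrite EFinB leeBlDr//; case: (Z + _)%E Z'0 keyQ => [u| |]//.
  rewrite !lee_fin => u0 keyQ; exact: max_queue_real_le.
  by move=> _ _; rewrite leey.
Qed.

End queueing.

(** * Mean excess of the maximal workload *)

Section mean_excess.
Context d (T : measurableType d) (R : realType) (P : probability T R).

(** The stop-loss transform of [Y]. *)
Definition mean_excess (Y : T -> R) (c : R) : R :=
  fine (\int[P]_w (Num.max (Y w - c) 0)%:E)%E.

Lemma measurable_excess (Y : T -> R) c : measurable_fun setT Y ->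
  measurable_fun setT (fun w => (Num.max (Y w - c) 0)%:E).
Proof.
by move=> mY; apply/measurable_EFinP; apply: measurable_maxr => //; exact: measurable_funB.
Qed.

Lemma integral_excess_fin (Y : T -> R) c : P.-integrable setT (EFin \o Y) ->
  (\int[P]_w (Num.max (Y w - c) 0)%:E = (mean_excess Y c)%:E)%E.
Proof.
move=> iY; rewrite /mean_excess fineK// ge0_fin_numE; last first.
  by apply: integral_ge0 => w _; rewrite lee_fin le_max lexx orbT.
have mY : measurable_fun setT Y by apply/measurable_EFinP; exact: measurable_int iY.
have iYc : P.-integrable setT (fun w => `|(Y w)%:E| + `|c%:E|)%E.
  apply: integrableD => //; first exact: integrable_abse.
  exact: finite_measure_integrable_cst.
have /integrableP[mYc] := iYc; apply: le_lt_trans; apply: ge0_le_integral => //.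
- by move=> w _; rewrite lee_fin le_max lexx orbT.
- exact: measurable_excess.
- exact: measurableT_comp.
move=> w _; rewrite gee0_abs ?adde_ge0// -EFinD lee_fin ge_max addr_ge0// andbT.
by rewrite (le_trans (ler_norm _))// ler_normB.
Qed.

Lemma excess_scale (Y : T -> R) a c : 0 < a -> P.-integrable setT (EFin \o Y) ->
  mean_excess (fun w => a * Y w) (a * c) = a * mean_excess Y c.
Proof.
move=> a0 iY; rewrite /mean_excess.
have mY : measurable_fun setT Y by apply/measurable_EFinP; exact: measurable_int iY.
under eq_integral => w _.
  rewrite -mulrBr -[X in Num.max _ X](mulr0 a) -maxr_pMr ?(ltW a0)// EFinM.
  over.
rewrite ge0_integralZl//.
- by rewrite integral_excess_fin.
- exact: measurable_excess.
- by move=> w _; rewrite lee_fin le_max lexx orbT.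
- by rewrite lee_fin ltW.
Qed.

End mean_excess.

Lemma integrable_standard d (T : measurableType d) (R : realType) (P : probability T R)
    (X : {RV P >-> R}) :
  (forall A : set R, measurable A -> distribution P X A = normal_prob 0 1 A) ->
  P.-integrable setT (EFin \o X).
Proof.
move=> lawX.
have mgf (t : R) : (\int[P]_w (expR (t * X w))%:E = (expR (t ^+ 2 / 2))%:E)%E.
  rewrite (@ge0_integral_normal_law _ _ _ _ _ 1 (fun x => (expR (t * x))%:E) lawX).
  - by rewrite normal_mgf// expr1n mulr1.
  - by apply/measurable_EFinP; apply: measurableT_comp => //; exact: mulrl_measurable.
  - by move=> x; rewrite lee_fin expR_ge0.
have mt (t : R) : measurable_fun setT (fun w => (expR (t * X w))%:E).
  by apply/measurable_EFinP; apply: measurableT_comp => //; exact: measurable_funM.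
apply/integrableP; split; first exact/measurable_EFinP.
(* The absolute value of [x] is at most [expR x + expR (- x)], and both exponential moments are
   finite. *)
apply: (@le_lt_trans _ _ (\int[P]_w ((expR (1 * X w))%:E + (expR (-1 * X w))%:E))%E).
  apply: ge0_le_integral => //.
  - by do 2 apply: measurableT_comp => //.
  - exact: emeasurable_funD.
  move=> w _; rewrite /= -EFinD lee_fin mul1r mulN1r.
  have := expR_ge1Dx (X w); have := expR_ge1Dx (- X w).
  have := expR_gt0 (X w); have := expR_gt0 (- X w).
  by case: (lerP 0 (X w)) => x0; [rewrite ger0_norm//|rewrite ltr0_norm//]; lra.
rewrite ge0_integralD//.
by rewrite !mgf -EFinD ltry.
Qed.


(** * Upper and lower bounds on the mean excess of the maximal workload *)

Section max_queue_excess.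
Context d (T : measurableType d) (R : realType) (P : probability T R).
Variables (sigma sigmaA : R) (W : nat -> R -> {RV P >-> R}) (WA : R -> {RV P >-> R}).
Hypotheses (sigma0 : 0 < sigma) (sigmaA0 : 0 < sigmaA).
Hypotheses (bmW : forall j, brownian_motion sigma (W j)) (bmA : brownian_motion sigmaA WA).
Hypothesis ind : mutually_independent P
  (fun k : option nat => sigma_process (if k is Some j then W j else WA)).
Variable X : {RV P >-> R}.
Hypothesis lawX : forall A : set R, measurable A -> distribution P X A = normal_prob 0 1 A.

Local Notation M := (max_queue_real W WA).
Local Notation psi N := (mean_excess P (M N)).
Local Notation G := (mean_excess P X).

(** [WA s] has the law of [sigmaA * sqrt s] times [X]. Since [bm_normal] speaks of increments and
    [WA 0] vanishes only almost surely, the proof passes through [WA s - WA 0]. *)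
Lemma bm_excess_law (s c : R) : 0 < s ->
  (\int[P]_w (Num.max (WA s w - c) 0)%:E =
   \int[P]_w (Num.max (sigmaA * Num.sqrt s * X w - c) 0)%:E)%E.
Proof.
move=> s0; set a := sigmaA * Num.sqrt s.
have a0 : 0 < a by rewrite mulr_gt0// sqrtr_gt0.
pose g (x : R) := Num.max (x - c) 0.
have cg : continuous g.
  move=> x; apply: (@continuous_max _ _ (fun x : R => x - c) (cst 0)); last exact: cst_continuous.
  by apply: cvgB; [exact: cvg_id|exact: cvg_cst].
have mg : measurable_fun [set: R] (EFin \o g).
  by apply/measurable_EFinP; exact: continuous_measurable_fun.
have g0 x : 0 <= g x by rewrite /g le_max lexx orbT.
have lawA := bm_normal bmA (lexx 0) s0; rewrite subr0 in lawA.
transitivity (\int[P]_w (EFin \o g) ((WA s \- WA 0)%R w))%E.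
  apply: ae_eq_integral => //.
  - exact: measurable_excess.
  - apply: measurableT_comp => //; exact: measurable_funB.
  by apply: filterS (bm_start bmA) => w WA0 _; rewrite /g /= WA0 subr0.
rewrite (@ge0_integral_normal_law _ _ _ P (WA s \- WA 0) _ (EFin \o g) lawA mg)//.
rewrite /= normal_scale//.
have mga : measurable_fun [set: R] (fun x => (g (a * x))%:E).
  by apply: measurableT_comp mg _ => //; exact: mulrl_measurable.
rewrite -(@ge0_integral_normal_law _ _ _ P X _ (fun x => (g (a * x))%:E) lawX mga)//.
by move=> x; rewrite lee_fin.
Qed.

Lemma ln_natr_gt0 N : (2 <= N)%N -> 0 < ln (N%:R : R).
Proof. by move=> N2; rewrite ln_gt0// ltr1n. Qed.

(** Pointwise, the excess of the maximum is at most the excess of [s + WA s] plus the error [Z] of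
    [max_queue_upper]. *)
Lemma mean_excess_max_queue_le (N : nat) (s eta x : R) : (2 <= N)%N ->
  s = sigma ^+ 2 / 2 * ln N%:R -> 0 < eta -> eta <= 2^-1 ->
  psi N (s + sigmaA * Num.sqrt s * x) <=
  sigmaA * Num.sqrt s * G x + (4 * sigma ^+ 2 + sigmaA ^+ 2 / eta + 2 * s * eta ^+ 2).
Proof.
move=> N2 sE eta0 eta1.
have s0 : 0 < s by rewrite sE mulr_gt0 ?ln_natr_gt0// divr_gt0// exprn_gt0.
set a := sigmaA * Num.sqrt s.
have a0 : 0 < a by rewrite mulr_gt0// sqrtr_gt0.
have [Z [mZ Z0 iZ HZ]] := max_queue_upper sigma0 sigmaA0 bmW bmA N2 sE eta0 eta1.
have iM := integrable_max_queue_real sigma0 sigmaA0 bmW bmA N.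
have iX := integrable_standard lawX.
rewrite -lee_fin EFinD -excess_scale//.
have iaX : P.-integrable setT (EFin \o (fun w => a * X w)).
  exact: (integrableZl measurableT a iX).
rewrite -!integral_excess_fin// -bm_excess_law//.
apply: le_trans (leeD (lexx _) iZ).
rewrite -ge0_integralD//; [|by move=> w _; rewrite lee_fin le_max lexx orbT|exact: measurable_excess].
apply: ae_ge0_le_integral => //.
- by move=> w _; rewrite lee_fin le_max lexx orbT.
- by apply: measurable_excess; exact: measurable_max_queue_real.
- by move=> w _; rewrite adde_ge0// lee_fin le_max lexx orbT.
- by apply: emeasurable_funD => //; exact: measurable_excess.
apply: filterS HZ => w HZ _.
case: (Z w) (Z0 w) HZ => [z| |]//; last by move=> _ _; rewrite addey// leey.
rewrite lee_fin => z0; rewrite lee_fin => HZ.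
rewrite -leeBlDr// -EFinB lee_fin lerBlDr.
rewrite ge_max addr_ge0 ?le_max ?lexx ?orbT// andbT.
have : WA s w - a * x <= Num.max (WA s w - a * x) 0 by rewrite le_max lexx.
lra.
Qed.

Lemma bm_prob (j : nat) (s y : R) : 0 < s ->
  P (W j s @^-1` `]-oo, y]) = normal_prob 0 (sigma * Num.sqrt s) `]-oo, y].
Proof.
move=> s0.
have := bm_normal (bmW j) (lexx 0) s0 (@measurable_itv R `]-oo, y]).
rewrite subr0 => <-; rewrite /pushforward.
have mS (Y : {RV P >-> R}) : measurable (Y @^-1` `]-oo, y]).
  by rewrite -[X in measurable X]setTI; apply: measurable_funP.
have PI (Y : {RV P >-> R}) :
    P (Y @^-1` `]-oo, y]) = (\int[P]_w (\1_(Y @^-1` `]-oo, y]) w)%:E)%E.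
  by rewrite integral_indic// setIT.
rewrite (PI (W j s)) (PI (W j s \- W j 0)).
apply: ae_eq_integral => //.
- exact/measurable_EFinP/measurable_indic/mS.
- exact/measurable_EFinP/measurable_indic/(mS (W j s \- W j 0)).
apply: filterS (bm_start (bmW j)) => w W0 _.
by congr EFin; rewrite !indicE; congr (nat_of_bool _)%:R; apply/idP/idP; rewrite !inE /= W0 subr0.
Qed.

(** The exceptional event of the lower bound: off it, some queue has [W j s] above [y]. *)
Definition low_event (N : nat) (s y : R) : set T :=
  \big[setI/setT]_(j < N) (W j s @^-1` `]-oo, y]).

Lemma low_event_prob (N : nat) (s y : R) (B : set R) : 0 < s -> measurable B ->
  P (low_event N s y `&` WA s @^-1` B) = (P (low_event N s y) * P (WA s @^-1` B))%E /\
  P (low_event N s y) = (fine (normal_prob 0 (sigma * Num.sqrt s) `]-oo, y]) ^+ N)%:E.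
Proof.
move=> s0 mB.
have sW j : sigma_process (W j) (W j s @^-1` `]-oo, y]).
  apply: sub_sigma_algebra; exists s; first exact: ltW.
  by exists (`]-oo, y]%classic); [exact: measurable_itv|rewrite setTI].
have sA : sigma_process WA (WA s @^-1` B).
  apply: sub_sigma_algebra; exists s; first exact: ltW.
  by exists B => //; rewrite setTI.
have pN : P (low_event N s y) = (\prod_(j < N) P (W j s @^-1` `]-oo, y]))%E.
  apply: (@mutually_independent_ord _ _ _ _ _ _ _ (fun j : 'I_N => Some (val j)) _ _ ind) => //.
  by move=> j k [/val_inj].
split; last first.
  rewrite pN; under eq_bigr do rewrite bm_prob// -[normal_prob _ _ _]fineK ?fin_num_measure//.
  by rewrite prodEFin prodr_const card_ord.
(* The last index [N] stands for [WA], the others for the queues. *)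
pose f (k : 'I_N.+1) : option nat := if (k < N)%N then Some (val k) else None.
pose E (k : 'I_N.+1) := if (k < N)%N then W k s @^-1` `]-oo, y] else WA s @^-1` B.
have injf : injective f.
  move=> j k; rewrite /f; case: ifPn => jN; case: ifPn => kN // jk.
    by apply: val_inj; case: jk.
  apply: val_inj; rewrite /=; move: jN kN; rewrite -!leqNgt => jN kN.
  by apply/eqP; rewrite eqn_leq (leq_trans _ kN) ?(leq_trans _ jN)// -ltnS.
have := @mutually_independent_ord _ _ _ _ _ _ _ f E injf ind.
rewrite !big_ord_recr/= /E /= ltnn.
under eq_bigr => k _ do rewrite ltn_ord.
move=> HE; rewrite [LHS]HE.
  by rewrite pN; congr (_ * _)%E; apply: eq_bigr => k _; rewrite ltn_ord.
by move=> k; rewrite /f; case: ifPn => // _; exact: sW.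
Qed.

(** Off the low event some [W j s] exceeds [2 * s - eps * (sigmaA * sqrt s)], so the maximum,
    bounded below by that queue at time [s], exceeds [s + WA s - eps * (sigmaA * sqrt s)]. The low
    event is independent of [WA s], so the two factors separate. *)
Lemma mean_excess_max_queue_ge (N : nat) (s eps x : R) : 0 < s ->
  (1 - fine (normal_prob 0 (sigma * Num.sqrt s) `]-oo, 2 * s - eps * (sigmaA * Num.sqrt s)]) ^+ N)
    * (sigmaA * Num.sqrt s * G (x + eps))
  <= psi N (s + sigmaA * Num.sqrt s * x).
Proof.
move=> s0; set a := sigmaA * Num.sqrt s; set y := 2 * s - eps * a.
have a0 : 0 < a by rewrite mulr_gt0// sqrtr_gt0.
set p := fine _.
have iM := integrable_max_queue_real sigma0 sigmaA0 bmW bmA N.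
have iX := integrable_standard lawX.
have iaX : P.-integrable setT (EFin \o (fun w => a * X w)) by exact: (integrableZl measurableT a iX).
set H := low_event N s y.
have mH : measurable H.
  rewrite /H /low_event; elim/big_ind : _ => //; first exact: measurableI.
  by move=> j _; rewrite -[X in measurable X]setTI; apply: measurable_funP.
have PH : P H = (p ^+ N)%:E by have [] := low_event_prob N y s0 (@measurableT _ R).
(* The pi-system of the low event and the whole space suffices to make the indicator measurable. *)
pose G2 : set_system T := [set A | A = H \/ A = setT].
pose c := a * (x + eps).
have mY : measurable_fun setT (fun w => Num.max (WA s w - c) 0).
  by apply: measurable_maxr => //; exact: measurable_funB.
have prod : (\int[P]_w (\1_(~` H) w * Num.max (WA s w - c) 0)%:E =
    \int[P]_w (\1_(~` H) w)%:E * \int[P]_w (Num.max (WA s w - c) 0)%:E)%E.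
  apply: (@ge0_integralM_sigma_indep _ _ _ _ G2) => //.
  - by move=> _ [->|->].
  - move=> _ _ [->|->] [->|->]; rewrite ?setIid ?setIT ?setTI; [by left|by left|by left|by right].
  - by right.
  - apply: measurable_indic; apply: (@measurableC _ (g_sigma_algebraType G2)).
    by apply: sub_sigma_algebra; left.
  - by move=> w; rewrite le_max lexx orbT.
  - move=> _ B [->|->] mB; last by rewrite setTI probability_setT mul1e.
    have mg : measurable_fun [set: R] (fun z => Num.max (z - c) 0).
      by apply: measurable_maxr => //; exact: measurable_funB.
    have mB' : measurable ((fun z => Num.max (z - c) 0) @^-1` B).
      by rewrite -[X in measurable X]setTI; exact: mg.
    by have [] := low_event_prob N y s0 mB'.
rewrite -lee_fin EFinM -excess_scale// -!integral_excess_fin//.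
have -> : (1 - p ^+ N)%:E = (\int[P]_w (\1_(~` H) w)%:E)%E.
  have mHc := measurableC mH.
  have PHc : P (~` H) = (1 - p ^+ N)%:E by rewrite (probability_setC _ mH) PH.
  by rewrite -PHc integral_indic// setIT.
rewrite -bm_excess_law// -prod; apply: ae_ge0_le_integral => //.
- by move=> w _; rewrite lee_fin mulr_ge0// le_max lexx orbT.
- apply/measurable_EFinP; apply: measurable_funM => //.
  by apply: measurable_indic; exact: measurableC.
- by move=> w _; rewrite lee_fin le_max lexx orbT.
- by apply: measurable_excess; exact: measurable_max_queue_real.
have aeQ := ae_foralln (ae_queue_sup_fin sigma0 sigmaA0 bmW bmA).
apply: filterS aeQ => w HQ _; rewrite lee_fin indicE.
have [|_] := boolP (w \in ~` H); last by rewrite mul0r le_max lexx orbT.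
rewrite mul1r inE => Hw.
have [j jN Wj] : exists2 j, (j < N)%N & y < W j s w.
  apply: contrapT => noj; apply: Hw; rewrite /H /low_event.
  apply: (@big_ind _ (fun A : set T => A w)) => // j _; have jN := ltn_ord j.
  rewrite /= in_itv/= leNgt; apply/negP => yW; apply: noj; by exists j.
have [reg Qj] := HQ j.
have Mj : W j s w + WA s w - s <= M N w.
  apply: (le_trans _ (le_max_queue_real _ _ w jN)).
  by rewrite -lee_fin -Qj; exact: (net_le_queue_sup j reg (ltW s0)).
have h : WA s w - c <= M N w - (s + a * x) by rewrite /c /y in Wj *; lra.
by rewrite ge_max !le_max h lexx orbT.
Qed.

(* The tail beyond the threshold is bounded below by the mass of the adjacent
   interval of length [eps / 2 * (sigmaA * sqrt s)]. *)
Lemma normal_cdf_power_le (eps : R) : 0 < eps -> exists2 C : R, 0 < C & forall N s,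
  (2 <= N)%N -> s = sigma ^+ 2 / 2 * ln N%:R -> eps * (sigmaA * Num.sqrt s) <= 2 * s ->
  0 <= fine (normal_prob 0 (sigma * Num.sqrt s) `]-oo, 2 * s - eps * (sigmaA * Num.sqrt s)]) ^+ N
    <= (C * Num.sqrt s)^-1.
Proof.
move=> eps0.
pose c1 := eps / 2 * sigmaA / (sigma * Num.sqrt (pi *+ 2)).
pose c2 := eps ^+ 2 * sigmaA ^+ 2 / (8 * sigma ^+ 2).
pose c3 := eps * sigmaA / sigma ^+ 2.
have pi0 : 0 < Num.sqrt (pi *+ 2 : R) by rewrite sqrtr_gt0 mulrn_wgt0// pi_gt0.
have c10 : 0 < c1 by rewrite !mulr_gt0// invr_gt0 mulr_gt0.
have c30 : 0 < c3 by rewrite !mulr_gt0// invr_gt0 exprn_gt0.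
have C0 : 0 < c1 * expR (- c2) * c3.
  by apply: mulr_gt0 => //; apply: mulr_gt0 => //; exact: expR_gt0.
exists (c1 * expR (- c2) * c3) => //.
move=> N s N2 sE small.
have s0 : 0 < s by rewrite sE mulr_gt0 ?ln_natr_gt0// divr_gt0// exprn_gt0.
set r := Num.sqrt s; have r0 : 0 < r by rewrite sqrtr_gt0.
have rr : r ^+ 2 = s by rewrite sqr_sqrtr// ltW.
rewrite -/r in small; set y := 2 * s - _; set p := fine _.
pose nu := normal_prob (0 : R) (sigma * r).
have sr0 : 0 < sigma * r by rewrite mulr_gt0.
have pE : nu `]-oo, y]%classic = p%:E by rewrite /p fineK ?fin_num_measure.
have p0 : 0 <= p by rewrite fine_ge0.
rewrite exprn_ge0//=.
pose l := eps / 2 * (sigmaA * r).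
have l0 : 0 < l by rewrite !mulr_gt0.
pose z := y + l.
have y0 : 0 <= y by rewrite /y subr_ge0.
(* The density at the right end [z] is its minimum over the interval from [y] to [z], because [y] is
   nonnegative. *)
pose dens := normal_peak (sigma * r) * expR (- z ^+ 2 / ((sigma * r) ^+ 2 *+ 2)).
have q_le : ((l * dens)%:E <= nu `]y, z]%classic)%E.
  have -> : ((l * dens)%:E = \int[lebesgue_measure]_(x in `]y, z]) dens%:E)%E.
    rewrite integral_cst//= lebesgue_measure_itv/= lte_fin ltrDl l0 -EFinB -EFinM.
    by rewrite /z addrAC subrr add0r mulrC.
  apply: ge0_le_integral => //.
  - by move=> x _; rewrite lee_fin mulr_ge0 ?expR_ge0// normal_peak_ge0.
  - by apply/measurable_EFinP; apply: measurable_funTS; exact: measurable_normal_pdf.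
  move=> x; rewrite /= in_itv/= => /andP[yx xz].
  rewrite lee_fin normal_pdfE ?gt_eqF// /dens ler_wpM2l ?normal_peak_ge0//.
  rewrite /normal_fun subr0 ler_expR !mulNr lerN2 ler_pM2r; last first.
    by rewrite invr_gt0 mulrn_wgt0// exprn_gt0.
  have x0 : 0 <= (x : R) := le_trans y0 (ltW yx).
  by rewrite ler_sqr// ?nnegrE// (le_trans x0 xz).
have p_le : p <= 1 - l * dens.
  have : (nu `]-oo, y]%classic + nu `]y, z]%classic <= 1)%E.
    have disj : `]-oo, y]%classic `&` `]y, z]%classic = set0 :> set R.
      by apply/seteqP; split => // x [/=]; rewrite !in_itv/= => xy /andP[yx _]; lra.
    have mU : measurable (`]-oo, y]%classic `|` `]y, z]%classic : set (measurableTypeR R)).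
      by apply: measurableU; exact: measurable_itv.
    have := probability_le1 (normal_prob (0 : R) (sigma * r)) mU.
    by rewrite measureU.
  rewrite pE => h; have := le_trans (leeD (lexx p%:E) q_le) h.
  by rewrite -EFinD lee_fin; lra.
have pexp : p ^+ N <= expR (- (N%:R * (l * dens))).
  rewrite -mulrN expRM_natl lerXn2r ?nnegrE ?expR_ge0//.
  by apply: le_trans p_le _; have := expR_ge1Dx (- (l * dens)); lra.
apply: (le_trans pexp); rewrite expRN lef_pV2 ?posrE ?expR_gt0//; last exact: mulr_gt0.
(* Expanding the square, the exponent at [z = 2 * s - l] is [- ln N + c3 * r - c2], so the factor
   [N] cancels and the product grows like [expR (c3 * r)]. Two uses of [1 + x <= expR x] then give
   the bound. *)
have ldens : N%:R * (l * dens) = c1 * expR (- c2) * expR (c3 * r).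
  have N0 : 0 < (N%:R : R) by rewrite ltr0n (leq_trans _ N2).
  have zE : - z ^+ 2 / ((sigma * r) ^+ 2 *+ 2) = - ln N%:R + c3 * r - c2.
    have lnE : ln N%:R = 2 / sigma ^+ 2 * r ^+ 2.
      by rewrite rr sE; field; rewrite gt_eqF.
    rewrite lnE /z /y /l /c2 /c3 -rr; field; by rewrite ?pnatr_eq0 ?gt_eqF.
  rewrite /dens zE !expRD expRN lnK ?posrE// /l /c1 /normal_peak exprMn.
  have -> : Num.sqrt (sigma ^+ 2 * r ^+ 2 * pi *+ 2) = sigma * r * Num.sqrt (pi *+ 2).
    rewrite -exprMn -mulrnAr sqrtrM ?sqr_ge0// sqrtr_sqr gtr0_norm//.
  by field; rewrite ?gt_eqF.
rewrite ldens.
have e1 : c3 * r <= expR (c3 * r) by have := expR_ge1Dx (c3 * r); lra.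
have cc : 0 < c1 * expR (- c2) by apply: mulr_gt0 => //; exact: expR_gt0.
apply: (@le_trans _ _ (c1 * expR (- c2) * expR (c3 * r))).
  by rewrite -mulrA ler_pM2l.
have := expR_ge1Dx (c1 * expR (- c2) * expR (c3 * r)); lra.
Qed.

End max_queue_excess.

(** * Mean excess, quantiles and costs *)

Section mean_excess_theory.
Context d (T : measurableType d) (R : realType) (P : probability T R).
Variable Y : T -> R.
Hypothesis iY : P.-integrable setT (EFin \o Y).

Let mY : measurable_fun setT Y.
Proof. by apply/measurable_EFinP; exact: measurable_int iY. Qed.

Lemma integrable_excess c : P.-integrable setT (fun w => (Num.max (Y w - c) 0)%:E).
Proof.
apply/integrableP; split; first exact: measurable_excess.
under eq_integral do rewrite gee0_abs ?lee_fin ?le_max ?lexx ?orbT//.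
by rewrite integral_excess_fin// ltry.
Qed.

Lemma mean_excess_ge0 c : 0 <= mean_excess P Y c.
Proof.
by apply: fine_ge0; apply: integral_ge0 => w _; rewrite lee_fin le_max lexx orbT.
Qed.

Lemma mean_excess_convex (u v t : R) : 0 <= t -> t <= 1 ->
  mean_excess P Y (t * u + (1 - t) * v) <=
  t * mean_excess P Y u + (1 - t) * mean_excess P Y v.
Proof.
move=> t0 t1; have t1' : 0 <= 1 - t by lra.
rewrite -lee_fin EFinD !EFinM -!integral_excess_fin//.
have i0 c w : (0 <= (Num.max (Y w - c) 0)%:E)%E by rewrite lee_fin le_max lexx orbT.
rewrite -!ge0_integralZl//; [|exact: measurable_excess|exact: measurable_excess].
rewrite -ge0_integralD//; last 4 first.
- by move=> w _; rewrite mule_ge0// lee_fin.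
- by apply: measurable_funeM; exact: measurable_excess.
- by move=> w _; rewrite mule_ge0// lee_fin.
- by apply: measurable_funeM; exact: measurable_excess.
apply: ge0_le_integral => //.
- exact: measurable_excess.
- by apply: emeasurable_funD; apply: measurable_funeM; exact: measurable_excess.
move=> w _; rewrite -!EFinM -EFinD lee_fin.
have a1 : Y w - u <= Num.max (Y w - u) 0 by rewrite le_max lexx.
have a2 : Y w - v <= Num.max (Y w - v) 0 by rewrite le_max lexx.
have b1 : 0 <= Num.max (Y w - u) 0 by rewrite le_max lexx orbT.
have b2 : 0 <= Num.max (Y w - v) 0 by rewrite le_max lexx orbT.
rewrite ge_max; apply/andP; split; last by rewrite addr_ge0// mulr_ge0.
have := ler_wpM2l t0 a1; have := ler_wpM2l t1' a2; lra.
Qed.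

(** In [c], the positive part of [Y - c] has slope [-1] below [Y] and 0 above it. This bound and the
    next enclose the difference quotients between tail probabilities, in place of a derivative. *)
Lemma mean_excessB_le (u v : R) : u <= v ->
  mean_excess P Y u - mean_excess P Y v <= (v - u) * fine (P (Y @^-1` `]u, +oo[)).
Proof.
move=> uv.
have mS : measurable (Y @^-1` `]u, +oo[) by rewrite -[X in measurable X]setTI; exact: mY.
rewrite lerBlDr -lee_fin EFinD EFinM (fineK (fin_num_measure P _ mS)) -!integral_excess_fin//.
rewrite -{1}(setIT (Y @^-1` _)) -integral_indic//.
have i0 c w : (0 <= (Num.max (Y w - c) 0)%:E)%E by rewrite lee_fin le_max lexx orbT.
have vu : (0 <= (v - u)%:E)%E by rewrite lee_fin subr_ge0.
have mI : measurable_fun setT (fun w => (\1_(Y @^-1` `]u, +oo[) w : R)%:E).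
  by apply/measurable_EFinP; exact: measurable_indic.
rewrite -ge0_integralZl//.
rewrite -ge0_integralD//; last 3 first.
- by move=> w _; rewrite mule_ge0// lee_fin.
- exact: measurable_funeM.
- exact: measurable_excess.
apply: ge0_le_integral => //.
- exact: measurable_excess.
- by apply: emeasurable_funD; [exact: measurable_funeM|exact: measurable_excess].
move=> w _; rewrite -EFinM -EFinD lee_fin indicE.
have a2 : Y w - v <= Num.max (Y w - v) 0 by rewrite le_max lexx.
have b2 : 0 <= Num.max (Y w - v) 0 by rewrite le_max lexx orbT.
have -> : (w \in Y @^-1` `]u, +oo[) = (u < Y w).
  by apply/idP/idP; rewrite inE /= in_itv/= andbT.
have [uY|Yu] := ltP u (Y w); rewrite ?mulr1n ?mulr0n ge_max; apply/andP; split; lra.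
Qed.

Lemma mean_excessB_ge (u v : R) : u <= v ->
  (v - u) * fine (P (Y @^-1` `]v, +oo[)) <= mean_excess P Y u - mean_excess P Y v.
Proof.
move=> uv.
have mS : measurable (Y @^-1` `]v, +oo[) by rewrite -[X in measurable X]setTI; exact: mY.
rewrite lerBrDr -lee_fin EFinD EFinM (fineK (fin_num_measure P _ mS)) -!integral_excess_fin//.
rewrite -{1}(setIT (Y @^-1` _)) -integral_indic//.
have i0 c w : (0 <= (Num.max (Y w - c) 0)%:E)%E by rewrite lee_fin le_max lexx orbT.
have vu : (0 <= (v - u)%:E)%E by rewrite lee_fin subr_ge0.
have mI : measurable_fun setT (fun w => (\1_(Y @^-1` `]v, +oo[) w : R)%:E).
  by apply/measurable_EFinP; exact: measurable_indic.
rewrite -ge0_integralZl//.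
rewrite -ge0_integralD//; last 3 first.
- by move=> w _; rewrite mule_ge0// lee_fin.
- exact: measurable_funeM.
- exact: measurable_excess.
apply: ge0_le_integral => //.
- by move=> w _; rewrite adde_ge0// mule_ge0// lee_fin.
- by apply: emeasurable_funD; [exact: measurable_funeM|exact: measurable_excess].
- exact: measurable_excess.
move=> w _; rewrite -EFinM -EFinD lee_fin indicE.
have a1 : Y w - u <= Num.max (Y w - u) 0 by rewrite le_max lexx.
have b1 : 0 <= Num.max (Y w - u) 0 by rewrite le_max lexx orbT.
have -> : (w \in Y @^-1` `]v, +oo[) = (v < Y w).
  by apply/idP/idP; rewrite inE /= in_itv/= andbT.
have [vY|Yv] := ltP v (Y w); rewrite ?mulr1n ?mulr0n.
  by rewrite (max_l (_ : 0 <= Y w - v)); lra.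
by rewrite (max_r (_ : Y w - v <= 0)); lra.
Qed.

Lemma mean_excess_lipschitz (u v : R) :
  `|mean_excess P Y u - mean_excess P Y v| <= `|u - v|.
Proof.
wlog uv : u v / u <= v.
  move=> H; have [|/ltW] := leP u v; first exact: H.
  by rewrite distrC (distrC u); exact: H.
have p1 c : fine (P (Y @^-1` `]c, +oo[)) <= 1.
  have mS : measurable (Y @^-1` `]c, +oo[) by rewrite -[X in measurable X]setTI; exact: mY.
  by rewrite -lee_fin fineK ?fin_num_measure// probability_le1.
have p0 c : 0 <= fine (P (Y @^-1` `]c, +oo[)) by exact: fine_ge0.
have vu : 0 <= v - u by rewrite subr_ge0.
have := mean_excessB_ge uv; have := mean_excessB_le uv.
have := ler_wpM2l vu (p1 u); have := mulr_ge0 vu (p0 v).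
move=> h1 h2 h3 h4; rewrite (distrC u) (ger0_norm vu) ger0_norm; lra.
Qed.

End mean_excess_theory.

(** * The normal quantile and the strict monotonicity of the limit cost on each side of it *)

Section normal_quantile_theory.
Context (R : realType).
Local Notation cdf := (@normal_cdf R).

(** On the interval from [x] to [y] the density is at least its value at [m], which is positive, so
    the interval has positive mass. *)
Lemma normal_cdf_lt (x y : R) : x < y -> cdf x < cdf y.
Proof.
move=> xy; rewrite /normal_cdf.
pose nu : probability (measurableTypeR R) R := normal_prob (0 : R) 1.
have mI (b : itv_bound R) (c : itv_bound R) : measurable ([set` Interval b c] : set (measurableTypeR R)).
  exact: measurable_itv.
have E : nu `]-oo, y]%classic = (nu `]-oo, x]%classic + nu `]x, y]%classic)%E.
  rewrite -measureU//.
    congr (nu _); apply/seteqP; split => z /=; rewrite !in_itv/= ?andbT.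
      by move=> zy; have [zx|xz] := leP z x; [left|right].
    by case=> [zx|/andP[//]]; rewrite (le_trans zx)// ltW.
  by apply/seteqP; split => // z [/=]; rewrite !in_itv/= => zx /andP[xz _]; lra.
pose m := Num.max `|x| `|y|.
pose dens := normal_peak (1 : R) * expR (- m ^+ 2 / (1 ^+ 2 *+ 2)).
have dens0 : 0 < dens by rewrite mulr_gt0 ?expR_gt0// normal_peak_gt0// oner_neq0.
have q_le : (((y - x) * dens)%:E <= nu `]x, y]%classic)%E.
  have -> : (((y - x) * dens)%:E = \int[lebesgue_measure]_(z in `]x, y]) dens%:E)%E.
    rewrite integral_cst//= lebesgue_measure_itv/= lte_fin xy -EFinB -EFinM.
    by rewrite mulrC.
  apply: ge0_le_integral => //.
  - by move=> z _; rewrite lee_fin ltW.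
  - by apply/measurable_EFinP; apply: measurable_funTS; exact: measurable_normal_pdf.
  move=> z; rewrite /= in_itv/= => /andP[xz zy].
  rewrite lee_fin normal_pdfE ?oner_neq0// /dens ler_wpM2l ?normal_peak_ge0//.
  rewrite /normal_fun subr0 ler_expR !mulNr lerN2 ler_pM2r; last first.
    by rewrite invr_gt0 mulrn_wgt0// exprn_gt0.
  rewrite -real_normK ?num_real// ler_sqr ?nnegrE//; last by rewrite /m le_max normr_ge0.
  rewrite /m; have := ler_norm y; have := ler_norm (- x); rewrite normrN.
  have m1 : `|x| <= Num.max `|x| `|y| by rewrite le_max lexx.
  have m2 : `|y| <= Num.max `|x| `|y| by rewrite le_max lexx orbT.
  have xz' : x < (z : R) := xz; have zy' : (z : R) <= y := zy.
  by move=> h1 h2; rewrite ler_norml; apply/andP; split; lra.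
change (fine (nu `]-oo, x]%classic) < fine (nu `]-oo, y]%classic)).
have -> : fine (nu `]-oo, y]%classic) = fine (nu `]-oo, x]%classic) + fine (nu `]x, y]%classic).
  by rewrite E fineD// fin_num_measure.
rewrite ltrDl.
apply: fine_gt0; apply/andP; split; last by rewrite -ge0_fin_numE// fin_num_measure.
by apply: lt_le_trans q_le; rewrite lte_fin mulr_gt0// subr_gt0.
Qed.

Section quantile.
Context d (T : measurableType d) (P : probability T R) (X : {RV P >-> R}).
Hypothesis lawX : forall A : set R, measurable A -> distribution P X A = normal_prob 0 1 A.

Lemma normal_cdfE (x : R) : ((cdf x)%:E = probability_theory.random_variable.cdf X x)%E.
Proof.
have -> : probability_theory.random_variable.cdf X x = normal_prob 0 1 `]-oo, x].
  by rewrite /probability_theory.random_variable.cdf lawX.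
by rewrite fineK// fin_num_measure.
Qed.

Lemma normal_tail (x : R) : fine (P (X @^-1` `]x, +oo[)) = 1 - cdf x.
Proof.
have mS : measurable (X @^-1` `]-oo, x]) by rewrite -[X in measurable X]setTI; apply: measurable_funP.
have -> : X @^-1` `]x, +oo[ = ~` (X @^-1` `]-oo, x]).
  by apply/seteqP; split => w /=; rewrite !in_itv/= andbT ltNge => /negP.
rewrite (probability_setC _ mS) fineB ?fin_num_measure//.
by congr (_ - _); rewrite -[LHS]/(fine (distribution P X `]-oo, x]%classic)) lawX.
Qed.

(** The cumulative distribution function tends to 0 at [-oo], so the set defining the quantile is
    bounded below and its infimum is a genuine lower bound. *)
Lemma normal_quantile_lt (p x : R) : 0 < p -> x < normal_quantile p -> cdf x < p.
Proof.
move=> p0 xq; rewrite ltNge; apply/negP => px.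
have cdfE y : (fine \o probability_theory.random_variable.cdf X) y = cdf y.
  by rewrite /= -normal_cdfE.
have [M HM] : exists M, forall y, y < M -> cdf y < p.
  have /fine_cvgP[_ /cvgr_lt /(_ p p0)[M [_ HM]]] := cvg_cdfNy0 X.
  by exists M => y yM; rewrite -cdfE; exact: HM.
have : normal_quantile p <= x.
  apply: ge_inf => //; exists M => y /= py; rewrite leNgt; apply/negP => /HM.
  by rewrite ltNge py.
by rewrite leNgt xq.
Qed.

(** The limit 1 at [+oo] makes the set nonempty; some element of it lies below [x], and strict
    monotonicity of the cumulative distribution function concludes. *)
Lemma normal_quantile_gt (p x : R) : p < 1 -> normal_quantile p < x -> p < cdf x.
Proof.
move=> p1 qx.
have cdfE y : (fine \o probability_theory.random_variable.cdf X) y = cdf y.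
  by rewrite /= -normal_cdfE.
have [M HM] : exists M, p <= cdf M.
  have /fine_cvgP[_ /cvgr_gt /(_ p p1)[M [_ HM]]] := cvg_cdfy1 X.
  by exists (M + 1); rewrite -cdfE; apply/ltW/HM; rewrite ltrDl.
have [y [py yx]] : exists y, p <= cdf y /\ y < x.
  apply: contrapT => noy.
  have : x <= normal_quantile p.
    apply: lb_le_inf; first by exists M.
    by move=> y /= py; rewrite leNgt; apply/negP => yx; apply: noy; exists y.
  by rewrite leNgt qx.
exact: le_lt_trans py (normal_cdf_lt yx).
Qed.

Local Notation G := (mean_excess P X).

(** The slope of the cost is [1 - P(X > x) / gamma], and right of the quantile [P(X > x) < gamma].
    The left side is symmetric. *)
Lemma standard_cost_right (gamma x y : R) : 0 < gamma ->
  normal_quantile (1 - gamma) < x -> x < y -> x + G x / gamma < y + G y / gamma.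
Proof.
move=> g0 qx xy.
have := normal_quantile_gt _ qx; rewrite ltrBlDr ltrDl => /(_ g0) cx.
have yx0 : 0 < y - x by rewrite subr_gt0.
have := mean_excessB_le (integrable_standard lawX) (ltW xy); rewrite normal_tail => h.
have : (y - x) * (1 - cdf x) < (y - x) * gamma by rewrite ltr_pM2l//; lra.
have : (G x - G y) / gamma < y - x -> x + G x / gamma < y + G y / gamma.
  by rewrite mulrBl; lra.
by move=> + h2; apply; rewrite ltr_pdivrMr//; exact: le_lt_trans h h2.
Qed.

Lemma standard_cost_left (gamma x y : R) : 0 < gamma -> gamma < 1 ->
  x < y -> y < normal_quantile (1 - gamma) -> y + G y / gamma < x + G x / gamma.
Proof.
move=> g0 g1 xy yq.
have := normal_quantile_lt _ yq; rewrite subr_gt0 => /(_ g1) cx.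
have yx0 : 0 < y - x by rewrite subr_gt0.
have := mean_excessB_ge (integrable_standard lawX) (ltW xy); rewrite normal_tail => h.
have : (y - x) * gamma < (y - x) * (1 - cdf y) by rewrite ltr_pM2l//; lra.
have : y - x < (G x - G y) / gamma -> y + G y / gamma < x + G x / gamma.
  by rewrite mulrBl; lra.
by move=> + h2; apply; rewrite ltr_pdivlMr//; exact: lt_le_trans h2 h.
Qed.

End quantile.
End normal_quantile_theory.

(** * The two costs in terms of mean excesses *)

Section cost_formula.
Context d (T : measurableType d) (R : realType) (P : probability T R).

Lemma integral_cost (Q Y : T -> R) (a c I : R) :
  P.-integrable setT (EFin \o Q) -> P.-integrable setT (EFin \o Y) ->
  (\int[P]_w (a * (I - Q w) + c * Num.max (Y w - I) 0)%:E =
   (a * (I - fine (\int[P]_w (Q w)%:E)) + c * mean_excess P Y I)%:E)%E.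
Proof.
move=> iQ iY.
have iIQ : P.-integrable setT (fun w => (a * (I - Q w))%:E).
  have iI : P.-integrable setT (EFin \o cst I) by exact: finite_measure_integrable_cst.
  exact: (integrableZl measurableT a (integrableB measurableT iI iQ)).
have iM : P.-integrable setT (fun w => (c * Num.max (Y w - I) 0)%:E).
  exact: (integrableZl measurableT c (integrable_excess iY I)).
under eq_integral do rewrite EFinD.
rewrite integralD// EFinD; congr (_ + _)%E.
  transitivity (\int[P]_w (a%:E * ((cst I%:E \- (EFin \o Q)) w)))%E.
    by apply: eq_integral => w _; rewrite /= EFinM EFinB.
  rewrite integralZl//; last first.
    by apply: integrableB => //; exact: finite_measure_integrable_cst.
  rewrite integralB//; last exact: finite_measure_integrable_cst.
  rewrite integral_cst//= probability_setT mule1 EFinM EFinB fineK//.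
  exact: integrable_fin_num.
transitivity (\int[P]_w (c%:E * (Num.max (Y w - I) 0)%:E))%E.
  by apply: eq_integral => w _; rewrite /= EFinM.
rewrite integralZl//; last exact: integrable_excess.
by rewrite integral_excess_fin// EFinM.
Qed.

Variables (sigma sigmaA : R) (W : nat -> R -> {RV P >-> R}) (WA : R -> {RV P >-> R}).
Hypotheses (sigma0 : 0 < sigma) (sigmaA0 : 0 < sigmaA).
Hypotheses (bmW : forall j, brownian_motion sigma (W j)) (bmA : brownian_motion sigmaA WA).

Definition queue_mean (i : nat) : R := fine (\int[P]_w (queue_real W WA i w)%:E)%E.

(** The integrand of [cost] equals a measurable one only almost everywhere, whence the appeal to
    [ae_eq_integral_nonmeasurable]. *)
Lemma costE (i N : nat) (h b I : R) : (0 < N)%N ->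
  cost W WA i N h b I = (N%:R * h * (I - queue_mean i) +
    (N%:R * h + b) * mean_excess P (max_queue_real W WA N) I)%:E.
Proof.
move=> N0; rewrite /cost /queue_mean -integral_cost; last 2 first.
- exact: (integrable_queue_real sigma0 sigmaA0 bmW bmA i).
- exact: (integrable_max_queue_real sigma0 sigmaA0 bmW bmA N).
apply: ae_eq_integral_nonmeasurable.
apply: filterS (ae_max_queue sigma0 sigmaA0 bmW bmA N0) => w [_ _ HQ ->].
by rewrite HQ -!EFinB -EFin_max -!EFinM -EFinD.
Qed.

Lemma approx_costE (X : {RV P >-> R}) (i N : nat) (h b I : R) :
  P.-integrable setT (EFin \o X) ->
  approx_cost W WA sigma sigmaA X i N h b I = (N%:R * h * (I - queue_mean i) +
    (N%:R * h + b) *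
      mean_excess P (fun w => approx_max_queue sigma sigmaA N (X w)) I)%:E.
Proof.
move=> iX; rewrite /approx_cost /queue_mean -integral_cost; last 2 first.
- exact: (integrable_queue_real sigma0 sigmaA0 bmW bmA i).
- pose c := sigma ^+ 2 / 2 * ln N%:R.
  have iC : P.-integrable setT (EFin \o cst c) by exact: finite_measure_integrable_cst.
  exact: (integrableD measurableT iC (integrableZl measurableT _ iX)).
apply: ae_eq_integral_nonmeasurable.
(* Only the finiteness of queue [i] is extracted here, so the number of queues is taken to be 1. *)
apply: filterS (ae_max_queue sigma0 sigmaA0 bmW bmA (ltn0Sn 0)) => w [_ _ HQ _].
by rewrite HQ -!EFinB -EFin_max -!EFinM -EFinD.
Qed.

End cost_formula.

(** * Convergence of the rescaled costs *)

Section minimizers.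
Context (R : realType) (phiN : nat -> R -> R) (phi : R -> R) (q L xh : R) (xN : nat -> R).
Hypothesis cvg_phi : forall x delta : R, 0 < delta ->
  \forall N \near \oo, `|phiN N x - phi x| <= delta.
Hypothesis phiN_convex : forall N (u v t : R), (2 <= N)%N -> 0 <= t -> t <= 1 ->
  phiN N (t * u + (1 - t) * v) <= t * phiN N u + (1 - t) * phiN N v.
Hypothesis phiN_lipschitz : forall N u v, (2 <= N)%N ->
  `|phiN N u - phiN N v| <= L * `|u - v|.
Hypothesis phi_right : forall x y, q < x -> x < y -> phi x < phi y.
Hypothesis phi_left : forall x y, x < y -> y < q -> phi y < phi x.
Hypothesis xN_min : forall N, (2 <= N)%N -> forall x, phiN N (xN N) <= phiN N x.
Hypothesis xh_min : forall x, phi xh <= phi x.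

(** If [x] were at or beyond [v] as seen from [u], with a value at most that at [u], then [v] would
    lie between [u] and [x], and convexity would contradict the strict inequality. *)
Lemma convex_between N u v x : (2 <= N)%N -> phiN N u < phiN N v ->
  (u < v -> x < v) /\ (v < u -> v < x) \/ phiN N u < phiN N x.
Proof.
move=> N2 uv; have [xu|ux] := leP (phiN N x) (phiN N u); last by right.
have key t : 0 <= t -> t <= 1 -> v = t * u + (1 - t) * x -> False.
  move=> t0 t1 vE; have := phiN_convex u x N2 t0 t1; rewrite -vE.
  have t1' : 0 <= 1 - t by lra.
  have := ler_wpM2l t1' xu; lra.
left; split=> [luv|lvu]; rewrite ltNge; apply/negP => xv.
  have xu0 : 0 < x - u by lra.
  apply: (key ((x - v) / (x - u))); first by rewrite divr_ge0; lra.
    by rewrite ler_pdivrMr//; lra.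
  by field; rewrite gt_eqF.
have xu0 : 0 < u - x by lra.
apply: (key ((v - x) / (u - x))); first by rewrite divr_ge0; lra.
  by rewrite ler_pdivrMr//; lra.
by field; rewrite gt_eqF.
Qed.

Lemma phiN_lt u v : phi u < phi v -> \forall N \near \oo, phiN N u < phiN N v.
Proof.
move=> uv; pose delta := (phi v - phi u) / 3.
have d0 : 0 < delta by rewrite divr_gt0// subr_gt0.
apply: filterS2 (cvg_phi u d0) (cvg_phi v d0) => N.
rewrite !ler_norml /delta => /andP[_ h1] /andP[h2 _]; lra.
Qed.

(** For large [N] the function is strictly lower at [q + eps / 2] than at [q + eps], so by convexity
    a minimizer lies left of [q + eps]; likewise on the other side. *)
Lemma minimizer_cvg (eps : R) : 0 < eps -> \forall N \near \oo, `|xN N - q| <= eps.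
Proof.
move=> e0.
have hr : phi (q + eps / 2) < phi (q + eps) by apply: phi_right; lra.
have hl : phi (q - eps / 2) < phi (q - eps) by apply: phi_left; lra.
have N2 : \forall N \near \oo, (2 <= N)%N by exact: nbhs_infty_ge.
apply: filterS3 N2 (phiN_lt hr) (phiN_lt hl) => N N2 hrN hlN.
have xr := xN_min N2 (q + eps / 2); have xl := xN_min N2 (q - eps / 2).
have {}xr : xN N < q + eps.
  case: (convex_between (xN N) N2 hrN) => [[h _]|]; last by rewrite ltNge xr.
  by apply: h; lra.
have {}xl : q - eps < xN N.
  case: (convex_between (xN N) N2 hlN) => [[_ h]|]; last by rewrite ltNge xl.
  by apply: h; lra.
rewrite ler_norml; apply/andP; split; lra.
Qed.

(** From above, compare with the value at [xh]. From below, the Lipschitz bound moves the minimizer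
    to the fixed point [q], where pointwise convergence applies, and [phi q] is at least
    [phi xh]. *)
Lemma minimum_cvg (eps : R) : 0 < eps ->
  \forall N \near \oo, `|phiN N (xN N) - phi xh| <= eps.
Proof.
move=> e0.
have L0 : 0 <= L.
  have := phiN_lipschitz 1 0 (leqnn 2); rewrite subr0 normr1 mulr1.
  exact: le_trans.
have L1 : 0 < L + 1 by rewrite ltr_wpDl.
have d0 : 0 < eps / 2 by rewrite divr_gt0.
have d1 : 0 < eps / 2 / (L + 1) by rewrite divr_gt0.
have N2 : \forall N \near \oo, (2 <= N)%N by exact: nbhs_infty_ge.
have H := filterI (cvg_phi xh d0) (cvg_phi q d0).
apply: filterS3 N2 (H _) (minimizer_cvg d1) => N N2 [hx hq] hN.
have := xN_min N2 xh; have := phiN_lipschitz q (xN N) N2; have := xh_min q.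
have : L * `|q - xN N| <= eps / 2.
  rewrite distrC; apply: (@le_trans _ _ ((L + 1) * (eps / 2 / (L + 1)))).
    by apply: ler_pM => //; rewrite lerDl.
  by rewrite mulrC divfK// gt_eqF.
move: hx hq; rewrite !ler_norml => /andP[? ?] /andP[? ?] ? ? /andP[? ?] ?.
by apply/andP; split; lra.
Qed.

End minimizers.

(** * The rescaled cost: convergence, convexity and a Lipschitz bound *)

Section scaled_cost.
Context d (T : measurableType d) (R : realType) (P : probability T R).
Variables (sigma sigmaA : R) (W : nat -> R -> {RV P >-> R}) (WA : R -> {RV P >-> R}).
Hypotheses (sigma0 : 0 < sigma) (sigmaA0 : 0 < sigmaA).
Hypotheses (bmW : forall j, brownian_motion sigma (W j)) (bmA : brownian_motion sigmaA WA).
Hypothesis ind : mutually_independent P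
  (fun k : option nat => sigma_process (if k is Some j then W j else WA)).
Variable X : {RV P >-> R}.
Hypothesis lawX : forall A : set R, measurable A -> distribution P X A = normal_prob 0 1 A.
Variable gamma : R.
Hypothesis gamma0 : 0 < gamma.

(** Both the time [s] at which the deterministic barrier minus the drift is largest and the value
    reached there. *)
Definition peak (N : nat) : R := sigma ^+ 2 / 2 * ln N%:R.
Definition spread (N : nat) : R := sigmaA * Num.sqrt (peak N).

Local Notation psi N := (mean_excess P (max_queue_real W WA N)).
Local Notation G := (mean_excess P X).

Definition limit_cost (x : R) : R := x + G x / gamma.
Definition scaled_cost (N : nat) (x : R) : R :=
  x + psi N (peak N + spread N * x) / (spread N * gamma).

Lemma peak_gt0 N : (2 <= N)%N -> 0 < peak N.
Proof. by move=> N2; rewrite mulr_gt0 ?ln_natr_gt0// divr_gt0// exprn_gt0. Qed.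

Lemma spread_gt0 N : (2 <= N)%N -> 0 < spread N.
Proof. by move=> N2; rewrite mulr_gt0// sqrtr_gt0 peak_gt0. Qed.

Lemma peak_large (A : R) : \forall N \near \oo, A <= peak N.
Proof.
near=> N.
have s20 : 0 < sigma ^+ 2 / 2 by rewrite divr_gt0// exprn_gt0.
rewrite /peak mulrC -ler_pdivrMr// -ler_expR lnK.
  by near: N; exact: nbhs_infty_ger.
rewrite posrE; apply: (@lt_le_trans _ _ (expR (A / (sigma ^+ 2 / 2)))); first exact: expR_gt0.
by near: N; exact: nbhs_infty_ger.
Unshelve. all: by end_near. Qed.

Lemma sqrt_peak_large (A : R) : \forall N \near \oo, A <= Num.sqrt (peak N).
Proof.
apply: filterS (peak_large (A ^+ 2)) => N h.
apply: (le_trans (ler_norm A)); rewrite -sqrtr_sqr; exact: ler_wsqrtr.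
Qed.

Lemma scaled_cost_cvg (x delta : R) : 0 < delta ->
  \forall N \near \oo, `|scaled_cost N x - limit_cost x| <= delta.
Proof.
move=> d0.
have iX := integrable_standard lawX.
pose dg := delta * gamma; have dg0 : 0 < dg by rewrite mulr_gt0.
(* With [eta = kappa / r], the term [sigmaA ^+ 2 / eta] is exactly [spread N * (dg / 2)], while
   [2 * s * eta ^+ 2] is the constant [2 * kappa ^+ 2]. *)
pose kappa := 2 * sigmaA / dg.
have k0 : 0 < kappa by rewrite divr_gt0 ?mulr_gt0.
pose eps := dg / 2; have eps0 : 0 < eps by rewrite divr_gt0.
have [C C0 HC] := normal_cdf_power_le sigma0 sigmaA0 eps0.
have G0 := mean_excess_ge0 P X (x + eps).
have N2 : \forall N \near \oo, (2 <= N)%N by exact: nbhs_infty_ge.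
(* The first term of [r1] ensures [eta <= 1 / 2]; the second makes the constant errors at most
   [spread N * (dg / 2)]. In [r2] they ensure the smallness condition of [normal_cdf_power_le] and a
   loss of at most [dg / 2] from the low event. *)
pose r1 := 2 * kappa + (4 * sigma ^+ 2 + 2 * kappa ^+ 2) * 2 / (sigmaA * dg).
pose r2 := eps * sigmaA + 2 * G (x + eps) / (C * dg).
apply: filterS3 N2 (sqrt_peak_large r1) (sqrt_peak_large r2) => N N2 hr1 hr2.
have s0 := peak_gt0 N2; have a0 := spread_gt0 N2.
set r := Num.sqrt (peak N) in hr1 hr2 *.
have r0 : 0 < r by rewrite sqrtr_gt0.
have rr : r ^+ 2 = peak N by rewrite sqr_sqrtr// ltW.
have up : psi N (peak N + spread N * x) <= spread N * (G x + dg).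
  have eta0 : 0 < kappa / r by rewrite divr_gt0.
  have eta1 : kappa / r <= 2^-1.
    rewrite ler_pdivrMr//; have : 0 <= (4 * sigma ^+ 2 + 2 * kappa ^+ 2) * 2 / (sigmaA * dg).
      have dn0 : 0 <= sigmaA * dg by rewrite mulr_ge0 ?ltW.
      have nm0 : 0 <= 4 * sigma ^+ 2 + 2 * kappa ^+ 2.
        by have := sqr_ge0 sigma; have := sqr_ge0 kappa; lra.
      by rewrite divr_ge0// mulr_ge0.
    rewrite /r1 in hr1; lra.
  apply: (le_trans (mean_excess_max_queue_le sigma0 sigmaA0 bmW bmA lawX x N2 (erefl (peak N)) eta0 eta1)).
  rewrite -/(spread N) mulrDr lerD2l.
  have -> : 2 * peak N * (kappa / r) ^+ 2 = 2 * kappa ^+ 2.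
    by rewrite -rr; field; rewrite gt_eqF.
  have -> : sigmaA ^+ 2 / (kappa / r) = spread N * (dg / 2).
    by rewrite /spread -/r /kappa; field; rewrite !gt_eqF.
  have h : 0 <= 2 * kappa by rewrite mulr_ge0// ltW.
  have : (4 * sigma ^+ 2 + 2 * kappa ^+ 2) * 2 / (sigmaA * dg) <= r by rewrite /r1 in hr1; lra.
  rewrite ler_pdivrMr ?mulr_gt0// /spread -/r; lra.
have low : spread N * (G x - dg) <= psi N (peak N + spread N * x).
  have G1 : 0 <= 2 * G (x + eps) / (C * dg).
    by rewrite divr_ge0 ?mulr_ge0// ltW// mulr_gt0.
  have small : eps * (sigmaA * r) <= 2 * peak N.
    rewrite -rr expr2; have := ler_wpM2r (ltW r0) hr2.
    have : 0 <= 2 * G (x + eps) / (C * dg) * r by rewrite mulr_ge0// ltW.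
    have : 0 <= r * r by rewrite mulr_ge0 ?ltW.
    rewrite /r2; lra.
  have /andP[p0 p1] := HC N _ N2 (erefl (peak N)) small.
  apply: le_trans (mean_excess_max_queue_ge sigma0 sigmaA0 bmW bmA ind lawX N eps x s0).
  rewrite -/(spread N) -/r mulrCA; apply: ler_wpM2l; first exact: ltW.
  set p := _ ^+ N in p0 p1 *.
  have pG : p * G (x + eps) <= dg / 2.
    apply: (@le_trans _ _ ((C * r)^-1 * G (x + eps))); first exact: ler_wpM2r.
    rewrite ler_pdivrMl ?mulr_gt0//.
    have e1 : 0 <= eps * sigmaA by rewrite mulr_ge0 ?ltW.
    have : 2 * G (x + eps) / (C * dg) <= r by rewrite /r2 in hr2; lra.
    rewrite ler_pdivrMr ?mulr_gt0//; lra.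
  (* Shifting the argument by [eps = dg / 2] costs the other half of [dg]. *)
  have := mean_excess_lipschitz iX x (x + eps).
  rewrite ler_norml opprD addrA subrr sub0r normrN (gtr0_norm eps0) => /andP[_].
  rewrite /eps; lra.
have -> : scaled_cost N x - limit_cost x =
    (psi N (peak N + spread N * x) - spread N * G x) / (spread N * gamma).
  by rewrite /scaled_cost /limit_cost; field; rewrite !gt_eqF.
have sg0 : 0 < spread N * gamma by rewrite mulr_gt0.
rewrite ler_norml ler_pdivlMr// ler_pdivrMr//; apply/andP; split.
  by have := low; rewrite /dg; lra.
by have := up; rewrite /dg; lra.
Qed.

Lemma scaled_cost_convex N u v t : (2 <= N)%N -> 0 <= t -> t <= 1 ->
  scaled_cost N (t * u + (1 - t) * v) <= t * scaled_cost N u + (1 - t) * scaled_cost N v.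
Proof.
move=> N2 t0 t1; have a0 := spread_gt0 N2.
have iM := integrable_max_queue_real sigma0 sigmaA0 bmW bmA N.
have := mean_excess_convex iM (peak N + spread N * u) (peak N + spread N * v) t0 t1.
have -> : t * (peak N + spread N * u) + (1 - t) * (peak N + spread N * v) =
    peak N + spread N * (t * u + (1 - t) * v) by ring.
have i0 : 0 <= (spread N * gamma)^-1 by rewrite invr_ge0 mulr_ge0 ?ltW.
move=> /(ler_wpM2r i0); rewrite /scaled_cost; lra.
Qed.

Lemma scaled_cost_lipschitz N u v : (2 <= N)%N ->
  `|scaled_cost N u - scaled_cost N v| <= (1 + gamma^-1) * `|u - v|.
Proof.
move=> N2; have a0 := spread_gt0 N2.
have iM := integrable_max_queue_real sigma0 sigmaA0 bmW bmA N.
have := mean_excess_lipschitz iM (peak N + spread N * u) (peak N + spread N * v).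
have -> : peak N + spread N * u - (peak N + spread N * v) = spread N * (u - v) by ring.
rewrite normrM (gtr0_norm a0) => h.
have -> : scaled_cost N u - scaled_cost N v = (u - v) +
    (psi N (peak N + spread N * u) - psi N (peak N + spread N * v)) / (spread N * gamma).
  by rewrite /scaled_cost; field; rewrite !gt_eqF.
apply: (le_trans (ler_normD _ _)); rewrite [leRHS]mulrDl mul1r lerD2l normrM.
have sg0 : 0 < spread N * gamma by rewrite mulr_gt0.
rewrite normfV (gtr0_norm sg0) ler_pdivrMr//; apply: (le_trans h).
by rewrite le_eqVlt; apply/orP; left; apply/eqP; field; rewrite gt_eqF.
Qed.

End scaled_cost.

(** * Main result *)

(** The trial value [Num.sqrt D / Num.sqrt n] attains the right-hand side, and the difference with
    any other value is a square divided by [beta]. *)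
Lemma amgm_minimizer (R : realType) (n D beta : R) : 0 < n -> 0 < D -> 0 < beta ->
  (forall beta', 0 < beta' -> beta^-1 * D + beta * n <= beta'^-1 * D + beta' * n) ->
  beta^-1 * D + beta * n = 2 * Num.sqrt n * Num.sqrt D.
Proof.
move=> n0 D0 b0 bmin.
have nn : Num.sqrt n ^+ 2 = n by rewrite sqr_sqrtr// ltW.
have DD : Num.sqrt D ^+ 2 = D by rewrite sqr_sqrtr// ltW.
have u0 : 0 < Num.sqrt n by rewrite sqrtr_gt0.
have v0 : 0 < Num.sqrt D by rewrite sqrtr_gt0.
set u := Num.sqrt n in nn u0 *; set v := Num.sqrt D in DD v0 *.
apply/eqP; rewrite eq_le; apply/andP; split.
  have -> : 2 * u * v = (v / u)^-1 * D + v / u * n.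
    by rewrite -nn -DD; field; rewrite !gt_eqF.
  by apply: bmin; rewrite divr_gt0.
rewrite -subr_ge0 -nn -DD.
have -> : beta^-1 * v ^+ 2 + beta * u ^+ 2 - 2 * u * v = beta^-1 * (v - beta * u) ^+ 2.
  by field; rewrite gt_eqF.
by rewrite mulr_ge0 ?sqr_ge0// invr_ge0 ltW.
Qed.

Lemma sqrtB_le (R : realType) (x y : R) : 0 <= x -> 0 < y ->
  `|Num.sqrt x - Num.sqrt y| <= `|x - y| / Num.sqrt y.
Proof.
move=> x0 y0; have sy0 : 0 < Num.sqrt y by rewrite sqrtr_gt0.
rewrite ler_pdivlMr//.
have -> : x - y = (Num.sqrt x - Num.sqrt y) * (Num.sqrt x + Num.sqrt y).
  by rewrite -subr_sqr !sqr_sqrtr// ltW.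
rewrite normrM ler_wpM2l// ger0_norm ?addr_ge0 ?sqrtr_ge0//.
by rewrite lerDr sqrtr_ge0.
Qed.

Theorem lemma5p12 (R : realType) (d : measure_display) (T : measurableType d)
    (P : probability T R) (sigma sigmaA : R)
    (W : nat -> R -> {RV P >-> R}) (WA : R -> {RV P >-> R})
    (X : {RV P >-> R}) (i : nat) (h b : nat -> R) (gamma : R)
    (I_ beta_ Ihat_ : nat -> R) :
  0 < sigma -> 0 < sigmaA ->
  (forall j, brownian_motion sigma (W j)) ->
  brownian_motion sigmaA WA ->
  mutually_independent P
    (fun k : option nat => sigma_process (if k is Some j then W j else WA)) ->
  (forall A : set R, measurable A -> distribution P X A = normal_prob 0 1 A) ->
  0 < gamma -> gamma < 1 ->
  (forall N, (2 <= N)%N -> 0 < h N) ->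
  (forall N, (2 <= N)%N -> 0 < b N) ->
  (forall N, (2 <= N)%N -> N%:R * h N / (N%:R * h N + b N) = gamma) ->
  (forall N, (2 <= N)%N -> 0 < beta_ N /\
    forall I beta, 0 < beta ->
      (total_cost W WA i N (h N) (b N) (I_ N) (beta_ N) <=
       total_cost W WA i N (h N) (b N) I beta)%E) ->
  (forall N, (2 <= N)%N -> forall I,
    (approx_cost W WA sigma sigmaA X i N (h N) (b N) (Ihat_ N) <=
     approx_cost W WA sigma sigmaA X i N (h N) (b N) I)%E) ->
  I_ = (fun N => sigma ^+ 2 / 2 * ln N%:R +
          sigma * sigmaA / Num.sqrt 2 * Num.sqrt (ln N%:R) *
          normal_quantile (1 - gamma))
       +o_\oo (fun N => Num.sqrt (ln N%:R))
  /\
  (fun N => fine (total_cost W WA i N (h N) (b N) (I_ N) (beta_ N))) =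
    (fun N => 2 * Num.sqrt N%:R * Num.sqrt
       (fine (approx_cost W WA sigma sigmaA X i N (h N) (b N) (Ihat_ N))))
    +o_\oo (fun N => N%:R * Num.sqrt (h N)).
Proof.
move=> sigma0 sigmaA0 bmW bmA ind lawX g0 g1 h0 b0 hb minI minIhat.
have iX := integrable_standard lawX.
pose s := peak sigma : nat -> R; pose a := spread sigma sigmaA : nat -> R.
pose q := normal_quantile (1 - gamma).
pose e := queue_mean W WA i.
pose phiN := scaled_cost sigma sigmaA W WA gamma.
pose phi := limit_cost X gamma.
have s0 N : (2 <= N)%N -> 0 < s N by move=> ?; exact: peak_gt0.
have a0 N : (2 <= N)%N -> 0 < a N by move=> ?; exact: spread_gt0.
have Nh0 N : (2 <= N)%N -> 0 < N%:R * h N.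
  by move=> N2; rewrite mulr_gt0 ?h0// ltr0n (leq_trans _ N2).
have NhbE N : (2 <= N)%N -> N%:R * h N + b N = N%:R * h N / gamma.
  by move=> N2; rewrite -(hb N N2) invf_div mulrCA divff ?mulr1// gt_eqF// Nh0.
(* Since [N h + b = N h / gamma], both costs at the rescaled level [x] take the same form, with
   [phiN] or [phi] inside the bracket. *)
pose D N x := N%:R * h N * (s N - e + a N * phiN N x).
pose Dhat N x := N%:R * h N * (s N - e + a N * phi x).
have costD N x : (2 <= N)%N -> cost W WA i N (h N) (b N) (s N + a N * x) = (D N x)%:E.
  move=> N2; rewrite (costE sigma0 sigmaA0 bmW bmA) ?(leq_trans _ N2)// NhbE//.
  have := a0 _ N2; rewrite /D /phiN /scaled_cost -/(s N) -/(a N) => aN.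
  by congr EFin; rewrite -/e; field; rewrite !gt_eqF.
have spreadE N : (2 <= N)%N -> sigma * sigmaA / Num.sqrt 2 * Num.sqrt (ln N%:R) = a N.
  move=> N2; rewrite /a /spread /peak sqrtrM ?divr_ge0 ?sqr_ge0// sqrtrM ?sqr_ge0//.
  by rewrite sqrtr_sqr gtr0_norm// sqrtrV//; ring.
have approxD N x : (2 <= N)%N ->
    approx_cost W WA sigma sigmaA X i N (h N) (b N) (s N + a N * x) = (Dhat N x)%:E.
  move=> N2; rewrite (approx_costE sigma0 sigmaA0 bmW bmA)// NhbE//.
  have aN := a0 _ N2; congr EFin; rewrite -/e.
  have -> : mean_excess P (fun w => approx_max_queue sigma sigmaA N (X w)) (s N + a N * x) =
      a N * mean_excess P X x.
    rewrite -excess_scale// /mean_excess; congr fine; apply: eq_integral => w _.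
    rewrite /approx_max_queue spreadE// -/(peak sigma N) -/(s N).
    by congr (Num.max _ _)%:E; ring.
  by rewrite /Dhat /phi /limit_cost; field; rewrite gt_eqF.
pose xN N := (I_ N - s N) / a N.
have INE N : (2 <= N)%N -> I_ N = s N + a N * xN N.
  by move=> N2; rewrite /xN; field; rewrite gt_eqF// a0.
pose xh N := (Ihat_ N - s N) / a N.
have IhatE N : (2 <= N)%N -> Ihat_ N = s N + a N * xh N.
  by move=> N2; rewrite /xh; field; rewrite gt_eqF// a0.
have totalE N x beta : (2 <= N)%N ->
    total_cost W WA i N (h N) (b N) (s N + a N * x) beta =
    (beta^-1 * D N x + beta * N%:R)%:E.
  by move=> N2; rewrite /total_cost costD// -EFinM -EFinD.
(* With [beta] frozen at [beta_ N], joint minimality gives minimality in the base-stock level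
   alone. *)
have xN_min N : (2 <= N)%N -> forall x, phiN N (xN N) <= phiN N x.
  move=> N2 x; have [bN /(_ (s N + a N * x) _ bN)] := minI N N2.
  rewrite {1}INE// !totalE// lee_fin lerD2r ler_pM2l ?invr_gt0//.
  by rewrite /D ler_pM2l ?Nh0// lerD2l ler_pM2l ?a0.
have xh_min N : (2 <= N)%N -> forall x, phi (xh N) <= phi x.
  move=> N2 x; have := minIhat N N2 (s N + a N * x).
  rewrite {1}IhatE// !approxD// lee_fin.
  by rewrite /Dhat ler_pM2l ?Nh0// lerD2l ler_pM2l ?a0.
have phi_cvg x delta : 0 < delta -> \forall N \near \oo, `|phiN N x - phi x| <= delta.
  by move=> d0; exact: (scaled_cost_cvg sigma0 sigmaA0 bmW bmA ind lawX g0 x d0).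
have phi_convex N u v t : (2 <= N)%N -> 0 <= t -> t <= 1 ->
    phiN N (t * u + (1 - t) * v) <= t * phiN N u + (1 - t) * phiN N v.
  exact: (scaled_cost_convex sigma0 sigmaA0 bmW bmA g0).
have phi_lip N u v : (2 <= N)%N -> `|phiN N u - phiN N v| <= (1 + gamma^-1) * `|u - v|.
  exact: (scaled_cost_lipschitz sigma0 sigmaA0 bmW bmA g0).
have phi_r x y : q < x -> x < y -> phi x < phi y by exact: (standard_cost_right lawX g0).
have phi_l x y : x < y -> y < q -> phi y < phi x by exact: (standard_cost_left lawX g0 g1).
have xN_cvg := minimizer_cvg phi_cvg phi_convex phi_r phi_l xN_min.
have min_cvg := minimum_cvg phi_cvg phi_convex phi_lip phi_r phi_l xN_min (xh_min 2 isT).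
pose m := phi (xh 2).
(* All rescaled approximate minimizers minimize the same [phi], so their common value does not
   depend on [N]. *)
have phi_xh N : (2 <= N)%N -> phi (xh N) = m.
  by move=> N2; apply/eqP; rewrite eq_le xh_min// xh_min.
have N2near : \forall N \near \oo, (2 <= N)%N by exact: nbhs_infty_ge.
pose k := sigma * sigmaA / Num.sqrt 2.
have k0 : 0 < k by rewrite divr_gt0 ?mulr_gt0// sqrtr_gt0.
split.
  apply/eqaddoP => eps eps0.
  have epsk : 0 < eps / k by rewrite divr_gt0.
  apply: filterS2 N2near (xN_cvg _ epsk) => N N2 hN.
  rewrite !fctE /= INE// spreadE// -/(peak sigma N) -/(s N) -/q.
  have -> : s N + a N * xN N - (s N + a N * q) = a N * (xN N - q) by ring.
  rewrite normrM -spreadE// -/k normrM (gtr0_norm k0) -mulrA mulrC -mulrA mulrC.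
  apply: (@le_trans _ _ (eps / k * k * `|Num.sqrt (ln N%:R)|)); last by rewrite divfK// gt_eqF.
  by apply: ler_wpM2r => //; apply: ler_wpM2r => //; exact: ltW.
apply/eqaddoP => eps eps0.
pose K := 4 * sigmaA.
have K0 : 0 < K by rewrite mulr_gt0.
have epsK : 0 < eps / K by rewrite divr_gt0.
(* Beyond this threshold the constant [e] and the term [a N * z], for every [z] of size at most
   [|m| + 1], are each at most a quarter of [s N], so the brackets stay of order [s N]. *)
pose A := 4 * `|e| + 16 * sigmaA ^+ 2 * (`|m| + 1) ^+ 2.
have H := filterI (peak_large sigma0 A) (min_cvg 1 ltr01).
apply: filterS3 N2near (min_cvg _ epsK) (H _) => N N2 hN [hA hN1].
have sN := s0 _ N2; have aN := a0 _ N2; have NhN := Nh0 _ N2; have hhN := h0 _ N2.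
have N0 : 0 < (N%:R : R) by rewrite ltr0n (leq_trans _ N2).
set u := phiN N (xN N) in hN hN1.
have sa : a N = sigmaA * Num.sqrt (s N) by [].
have sqs : Num.sqrt (s N) ^+ 2 = s N by rewrite sqr_sqrtr// ltW.
set r := Num.sqrt (s N) in sa sqs.
have r0 : 0 < r by rewrite sqrtr_gt0.
have base z : `|z| <= `|m| + 1 -> s N / 4 <= s N - e + a N * z.
  move=> zB; pose B := `|m| + 1; have B0 : 0 <= B by rewrite addr_ge0.
  have e1 : 0 <= `|e| by []; have e2 := ler_norm e.
  have B2 : 0 <= 16 * sigmaA ^+ 2 * B ^+ 2.
    by apply: mulr_ge0; [apply: mulr_ge0 => //|]; exact: sqr_ge0.
  have rB : 4 * sigmaA * B <= r.
    rewrite -ler_sqr ?nnegrE ?mulr_ge0 ?(ltW sigmaA0) ?(ltW r0)// sqs.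
    by move: hA; rewrite /A -/B -/(s N) !exprMn -natrX; lra.
  have saB : sigmaA * r * B <= s N / 4.
    by rewrite -sqs; have := ler_wpM2r (ltW r0) rB; lra.
  have az : - (sigmaA * r * B) <= a N * z.
    rewrite sa -mulrN; apply: ler_wpM2l; first by rewrite mulr_ge0 ?ltW.
    by move: zB; rewrite ler_norml -/B => /andP[].
  by move: hA; rewrite /A -/B -/(s N); lra.
have um : `|u| <= `|m| + 1.
  rewrite -(subrK m u) (le_trans (ler_normD _ _))// addrC lerD2l; exact: hN1.
have mm : `|m| <= `|m| + 1 by rewrite lerDl.
have s4 : 0 < s N / 4 by rewrite divr_gt0.
set Bu := s N - e + a N * u; set Bm := s N - e + a N * m.
have Bu0 : 0 < Bu := lt_le_trans s4 (base _ um).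
have Bm0 : 0 < Bm := lt_le_trans s4 (base _ mm).
have DE : D N (xN N) = N%:R * h N * Bu by [].
have D0 : 0 < D N (xN N) by rewrite DE mulr_gt0.
rewrite !fctE /=.
have [bN minN] := minI N N2.
rewrite {1}INE// {1}IhatE// totalE// approxD//=.
(* With the level frozen at [I_ N], [beta_ N] is optimal. *)
rewrite (@amgm_minimizer _ N%:R (D N (xN N)) (beta_ N))//; last first.
  move=> beta' beta'0; have := minN (I_ N) beta' beta'0.
  by rewrite {1 2}INE// !totalE// lee_fin.
have -> : Dhat N (xh N) = N%:R * h N * Bm by rewrite /Dhat phi_xh.
rewrite DE !(sqrtrM _ (ltW NhN)) !(sqrtrM _ (ltW N0)).
set n := Num.sqrt N%:R; have n0 : 0 < n by rewrite sqrtr_gt0.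
have nn : n ^+ 2 = N%:R by rewrite sqr_sqrtr// ltW.
set hh := Num.sqrt (h N); have hh0 : 0 <= hh by exact: sqrtr_ge0.
have -> : 2 * n * (n * hh * Num.sqrt Bu) - 2 * n * (n * hh * Num.sqrt Bm) =
    2 * (N%:R * hh) * (Num.sqrt Bu - Num.sqrt Bm) by rewrite -nn; ring.
have Nhh : 0 <= N%:R * hh by rewrite mulr_ge0// ltW.
have Nhh2 : 0 <= 2 * (N%:R * hh) by rewrite mulr_ge0.
rewrite normrM (ger0_norm Nhh2) (ger0_norm Nhh).
have sqBm : r / 2 <= Num.sqrt Bm.
  have -> : r / 2 = Num.sqrt (s N / 4).
    have -> : s N / 4 = (r / 2) ^+ 2 by rewrite -sqs; field.
    by rewrite sqrtr_sqr ger0_norm// divr_ge0 ?ltW.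
  by apply: ler_wsqrtr; exact: base.
(* The brackets differ by [sigmaA * r * (u - m)] and the denominator is at least [r / 2], so [r]
   cancels; with the prefactor 2 this explains [K = 4 * sigmaA]. *)
have dB : `|Num.sqrt Bu - Num.sqrt Bm| <= 2 * sigmaA * `|u - m|.
  apply: (le_trans (sqrtB_le (ltW Bu0) Bm0)).
  have -> : Bu - Bm = a N * (u - m) by rewrite /Bu /Bm; ring.
  rewrite normrM (gtr0_norm aN) ler_pdivrMr ?sqrtr_gt0//.
  have um0 : 0 <= 2 * sigmaA * `|u - m| by rewrite mulr_ge0// mulr_ge0// ltW.
  by have := ler_wpM2l um0 sqBm; rewrite sa; lra.
have uK : 4 * sigmaA * `|u - m| <= eps.
  by rewrite -/K mulrC -ler_pdivlMr.
have := ler_wpM2l Nhh2 dB; have := ler_wpM2l Nhh uK; lra.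
Qed.
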